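(* Let $B>0$ and consider the arc-length parametrized curves $X:\mathbf R\to\mathbf C$ satisfying $$B\langle X,N\rangle=k\quad\text{on }\mathbf R.$$ (i) Each of these curves is convex, properly embedded and asymptotic to the boundary of a cone with vertex at the origin. After a rotation about the origin, it is the graph of an even function. (ii) The curves form a one-dimensional family parametrized by their distance to the origin, which can take on any value in $[0,\infty)$: for every $d\in[0,\infty)$ there is, up to rotation about the origin and reparametrization, exactly one such curve with $\min|X|=d$. (iii) Under the curve shortening flow these curves expand forever as governed by the scaling function $g(t)=\sqrt{2Bt+1}$, i.e. $\hat X(u,t)=\sqrt{2Bt+1}\,X(u)$, $t\ge0$, is the curve shortening flow of $X$ (up to tangential diffeomorphisms).
   Context: The plane is identified with $\mathbf C$, with the real inner product $\langle z,w\rangle=\mathrm{Re}(z\bar w)$. Curves are smooth, defined on all of $\mathbf R$ and parametrized by arc length ($|X'|=1$). $T=X'$ is the unit tangent, $N=iT$ the leftward pointing normal, and $k=\langle X'',N\rangle$ the signed curvature. A family $\hat X(u,t)$ of immersed curves with $\hat X(u,0)=X(u)$ is the curve shortening flow of $X$ (up to tangential diffeomorphisms) if $\langle\partial_t\hat X(u,t),N(u,t)\rangle=k(u,t)$ for all $(u,t)$, where $N(u,t)$ and $k(u,t)$ are the leftward normal and signed curvature of $u\mapsto\hat X(u,t)$. A cone with vertex at the origin is a closed planar sector bounded by two rays from the origin (for the straight lines through the origin, which are the curves at distance $0$, the cone is a half-plane and its boundary is the line itself). The curve is asymptotic to the boundary of the cone if along each of its two ends the distance from $X(s)$ to the corresponding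 boundary ray tends to $0$. *)

(* Defs.v *)
From Stdlib Require Import Reals.
From Coquelicot Require Import Coquelicot.

Open Scope R_scope.

Definition inner (z w : C) : R := Re (Cmult z (Cconj w)).

Definition expi (th : R) : C := (cos th, sin th).

Definition smooth (f : R -> R) : Prop := forall n s, ex_derive_n f n s.

Definition smooth_curve (X : R -> C) : Prop :=
  smooth (fun s => Re (X s)) /\ smooth (fun s => Im (X s)).

Definition vderiv (X : R -> C) (s : R) : C :=
  (Derive (fun r => Re (X r)) s, Derive (fun r => Im (X r)) s).

Definition immersed (X : R -> C) : Prop :=
  smooth_curve X /\ forall s, vderiv X s <> RtoC 0.

Definition arclength_curve (X : R -> C) : Prop :=
  smooth_curve X /\ forall s, Cmod (vderiv X s) = 1.

(* Derivative of Y with respect to the arc length of X.  The tangent, normal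
   and curvature below make sense for every immersed curve, as the flow does
   not preserve |X'| = 1; see [tangent_arclength] and [curvature_arclength]
   for the case of unit speed. *)
Definition arc_deriv (X Y : R -> C) (s : R) : C :=
  Cdiv (vderiv Y s) (RtoC (Cmod (vderiv X s))).

Definition tangent (X : R -> C) : R -> C := arc_deriv X X.

Definition normal (X : R -> C) (s : R) : C := Cmult Ci (tangent X s).

Definition curvature (X : R -> C) (s : R) : R :=
  inner (arc_deriv X (tangent X) s) (normal X s).

Lemma arc_deriv_arclength (X Y : R -> C) (s : R) :
  arclength_curve X -> arc_deriv X Y s = vderiv Y s.
Proof.
  intros [_ H]; unfold arc_deriv; rewrite H; field.
Qed.

Lemma tangent_arclength (X : R -> C) (s : R) :
  arclength_curve X -> tangent X s = vderiv X s.
Proof. apply arc_deriv_arclength. Qed.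

Lemma curvature_arclength (X : R -> C) (s : R) :
  arclength_curve X ->
  curvature X s = inner (vderiv (vderiv X) s) (normal X s).
Proof.
  intros H; unfold curvature; rewrite arc_deriv_arclength by exact H.
  assert (E : forall t, tangent X t = vderiv X t)
    by (intros t; now apply tangent_arclength).
  f_equal; apply (f_equal2 pair); apply Derive_ext; intros t; now rewrite E.
Qed.

Definition expander (B : R) (X : R -> C) : Prop :=
  arclength_curve X /\
  forall s, B * inner (X s) (normal X s) = curvature X s.

(* The curve lies on one side of each of its tangent lines; the side is not
   fixed because the curve may be traversed in either direction. *)
Definition convex_curve (X : R -> C) : Prop :=
  forall s,
    (forall r, 0 <= inner (Cminus (X r) (X s)) (normal X s)) \/
    (forall r, inner (Cminus (X r) (X s)) (normal X s) <= 0).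

(* Compact subsets of the plane are the closed bounded ones (Heine-Borel). *)
Definition proper_curve (X : R -> C) : Prop :=
  forall K : C -> Prop,
    closed K -> (exists M, forall z, K z -> Cmod z <= M) ->
    compact (fun s => K (X s)).

Definition properly_embedded (X : R -> C) : Prop :=
  immersed X /\ (forall s r, X s = X r -> s = r) /\ proper_curve X.

Definition ray (a : R) (z : C) : Prop :=
  exists r, 0 <= r /\ z = Cmult (RtoC r) (expi a).

Definition dist_to (E : C -> Prop) (z : C) : R :=
  real (Glb_Rbar (fun r => exists w, E w /\ r = Cmod (Cminus z w))).

(* The cone is { r e^{i th} : 0 <= r, a <= th <= b }, with boundary rays at
   the angles a and b; b = a + PI gives the half-planes.  The two cases
   correspond to the two directions in which the curve can be traversed. *)
Definition asymptotic_to_cone (X : R -> C) : Prop :=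
  exists a b, a < b <= a + PI /\
    ((is_lim (fun s => dist_to (ray a) (X s)) m_infty 0 /\
      is_lim (fun s => dist_to (ray b) (X s)) p_infty 0) \/
     (is_lim (fun s => dist_to (ray b) (X s)) m_infty 0 /\
      is_lim (fun s => dist_to (ray a) (X s)) p_infty 0)).

Definition rotate (th : R) (X : R -> C) (s : R) : C := Cmult (expi th) (X s).

Definition is_graph_of (X : R -> C) (f : R -> R) : Prop :=
  forall x y : R, (exists s, X s = (x, y)) <-> y = f x.

Definition even_function (f : R -> R) : Prop := forall x, f (- x) = f x.

Definition distance_to_origin (X : R -> C) (d : R) : Prop :=
  (exists s, Cmod (X s) = d) /\ forall s, d <= Cmod (X s).

(* Orientation-reversing reparametrizations are allowed. *)
Definition diffeomorphism (phi : R -> R) : Prop :=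
  smooth phi /\
  exists psi, smooth psi /\
    (forall s, psi (phi s) = s) /\ (forall s, phi (psi s) = s).

Definition same_up_to_rotation_and_reparametrization (X Y : R -> C) : Prop :=
  exists th phi, diffeomorphism phi /\ forall s, Y s = rotate th X (phi s).

(* Curve shortening flow on [0, oo) up to tangential diffeomorphisms; the time
   derivative V is taken within [0, oo), hence is one-sided at t = 0. *)
Definition curve_shortening_flow (X : R -> C) (Xh : R -> R -> C) : Prop :=
  (forall u, Xh u 0 = X u) /\
  (forall t, 0 <= t -> immersed (fun u => Xh u t)) /\
  (forall u t, 0 <= t ->
     exists V : C,
       @filterdiff R_AbsRing R_NormedModule C_R_NormedModule
         (fun r => Xh u r) (within (fun r => 0 <= r) (locally t))
         (fun h => @scal R_AbsRing C_R_NormedModule h V) /\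
       inner V (normal (fun v => Xh v t) u) = curvature (fun v => Xh v t) u).

(* Main.v *)
Require Import Defs.
From Stdlib Require Import Reals Lra.
From Coquelicot Require Import Coquelicot.
Open Scope R_scope.

(* Write X = (tau + i nu) T with T = e^{i theta} the unit tangent.  The equation
   of an expander becomes the autonomous system tau' = 1 + B nu^2,
   nu' = - B tau nu, theta' = B nu, for which nu e^{B (tau^2 + nu^2) / 2} is
   constant.  Hence nu is a function of tau, and tau is found by a quadrature,
   which gives existence and uniqueness for each value d of |nu| at the unique
   zero of tau, the point closest to the origin.  Reversing time reflects a
   solution, so the curve is symmetric.  The polar angle is monotone in the
   direction opposite to theta, which keeps |theta| below a bound L < pi/2:
   the curve is a convex graph.  Finally nu decays like e^{-B tau^2 / 2} and
   L - theta <= nu far out, so the ends approach rays. *)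

(** No theorem on ordinary differential equations is used. The one tool is the inverse of a function
    whose slope is bounded below by a positive constant. It yields [nu] from the first integral,
    [tau] from the quadrature, the zero of the tangential part of a given curve, and the parameter
    as a function of the abscissa. Uniqueness comes from the same inversions.

    Two estimates need more than monotonicity. The bound [L < PI / 2] must be strict, so that the
    slope [cos theta] of the abscissa stays away from 0 and the graph covers the whole line. And
    convergence of [theta] to [L] alone does not place the end near a ray, because the angular
    defect is multiplied by [tau]; the rate [L - theta <= nu] lets the decay of [nu] beat that
    factor. *)

(** * Calculus on the line: monotonicity, global inverses, smoothness *)

Lemma derivative_lower_bound (f f' : R -> R) (m a b : R) :
  (forall x, is_derive f x (f' x)) -> a <= b ->
  (forall x, a <= x <= b -> m <= f' x) -> m * (b - a) <= f b - f a.
Proof.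
  intros Hf Hab Hm.
  destruct (MVT_gen f a b f') as [c [Hc E]].
  - intros x _; apply Hf.
  - intros x _; apply derivable_continuous_pt; exists (f' x).
    apply is_derive_Reals, Hf.
  - rewrite Rmin_left, Rmax_right in Hc by lra.
    rewrite E; apply Rmult_le_compat_r; [lra | auto].
Qed.

Lemma derivative_pos_increasing (f f' : R -> R) (a b : R) :
  (forall x, is_derive f x (f' x)) -> a < b ->
  (forall x, a <= x <= b -> 0 < f' x) -> f a < f b.
Proof.
  intros Hf Hab Hp.
  destruct (MVT_gen f a b f') as [c [Hc E]].
  - intros x _; apply Hf.
  - intros x _; apply derivable_continuous_pt; exists (f' x).
    apply is_derive_Reals, Hf.
  - rewrite Rmin_left, Rmax_right in Hc by lra.
    specialize (Hp c Hc); nra.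
Qed.

Lemma derivative_zero_constant (f : R -> R) (a b : R) :
  (forall x, is_derive f x 0) -> f a = f b.
Proof.
  intros Hf.
  destruct (Rtotal_order a b) as [H | [-> | H]]; [ | reflexivity | symmetry];
    apply (eq_is_derive f); auto.
Qed.

Lemma continuous_primitive (f : R -> R) (a : R) :
  (forall x, ex_derive f x) ->
  exists F : R -> R, F a = 0 /\ forall x, is_derive F x (f x).
Proof.
  intros Hf; exists (RInt f a); split; [exact (RInt_point a f) |].
  assert (Hc : forall x, continuous f x)
    by (intros x; now apply (ex_derive_continuous f)).
  intros x; apply is_derive_RInt with a; [ | apply Hc].
  apply filter_forall; intros y; apply (RInt_correct f).
  apply (ex_RInt_continuous f); intros; apply Hc.
Qed.

(** The slope bound makes [F] expand distances by at least [m]. This gives injectivity,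
    surjectivity, and a Lipschitz inverse; the difference quotients of the inverse are then
    reciprocals of those of [F]. *)
Lemma inverse_function (F f : R -> R) (m : R) :
  0 < m -> (forall x, is_derive F x (f x)) -> (forall x, m <= f x) ->
  exists G : R -> R,
    (forall x, G (F x) = x) /\ (forall y, F (G y) = y) /\
    (forall y, is_derive G y (/ f (G y))).
Proof.
  intros Hm HF Hf.
  assert (Hlow : forall a b, a <= b -> m * (b - a) <= F b - F a)
    by (intros; apply derivative_lower_bound with f; auto).
  assert (Hcont : continuity F).
  { intros x; apply derivable_continuous_pt; exists (f x).
    apply is_derive_Reals, HF. }
  assert (Hsurj : forall y, {x | F x = y}).
  (* Growth at rate [m] on either side of 0 makes [F] pass [y] within distance [r]. *)
  { intros y; set (r := Rabs (y - F 0) / m).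
    assert (Hr : m * r = Rabs (y - F 0)) by (unfold r; field; lra).
    assert (Hr0 : 0 <= r)
      by (apply Rdiv_le_0_compat; [apply Rabs_pos | lra]).
    assert (H1 := Hlow 0 r Hr0).
    assert (H2 := Hlow (- r) 0 ltac:(lra)).
    assert (H3 := Rle_abs (y - F 0)).
    assert (H4 := Rle_abs (- (y - F 0))); rewrite Rabs_Ropp in H4.
    destruct (IVT_gen F (- r) r y Hcont) as [x [_ E]].
    - rewrite Rmin_left, Rmax_right; nra.
    - exists x; exact E. }
  set (G := fun y => proj1_sig (Hsurj y)).
  assert (FG : forall y, F (G y) = y) by (intros y; exact (proj2_sig (Hsurj y))).
  assert (Hinj : forall a b, m * Rabs (b - a) <= Rabs (F b - F a)).
  { intros a b; destruct (Rle_dec a b) as [H | H].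
    - rewrite (Rabs_pos_eq (b - a)) by lra.
      eapply Rle_trans; [apply Hlow, H | apply Rle_abs].
    - rewrite <- (Rabs_Ropp (b - a)), <- (Rabs_Ropp (F b - F a)).
      rewrite (Rabs_pos_eq (- (b - a))) by lra.
      eapply Rle_trans; [ | apply Rle_abs].
      replace (- (b - a)) with (a - b) by ring.
      replace (- (F b - F a)) with (F a - F b) by ring.
      apply Hlow; lra. }
  exists G; split; [ | split; [exact FG |]].
  - intros x.
    assert (H := Hinj (G (F x)) x); rewrite FG, Rminus_diag, Rabs_R0 in H.
    assert (H0 := Rabs_pos (x - G (F x))).
    destruct (Req_dec (x - G (F x)) 0) as [E | E]; [lra |].
    apply Rabs_no_R0 in E; nra.
  - intros y; apply is_derive_Reals; intros eps Heps.
    assert (HF' := proj1 (is_derive_Reals _ _ _) (HF (G y))).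
    (* With [k] the increment of the inverse, the error [k / h - / f] equals the error of [h / k]
       times two factors, each at most [/ m]; hence the tolerance [eps * (m * m)]. The radius
       [m * delta] works because [k] is at most [h / m] in absolute value. *)
    destruct (HF' (eps * (m * m))) as [delta Hdelta];
      [apply Rmult_lt_0_compat; nra |].
    assert (Hmd : 0 < m * delta)
      by (apply Rmult_lt_0_compat; [lra | apply cond_pos]).
    exists (mkposreal _ Hmd); simpl; intros h Hh0 Hh.
    set (k := G (y + h) - G y).
    assert (Fk : F (G y + k) = y + h)
      by (replace (G y + k) with (G (y + h)) by (unfold k; ring); apply FG).
    assert (Hk0 : k <> 0)
      by (intros E; rewrite E, Rplus_0_r, FG in Fk; lra).
    assert (Hk : m * Rabs k <= Rabs h).
    { assert (H := Hinj (G y) (G y + k)); rewrite Fk, FG in H.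
      now replace (G y + k - G y) with k in H by ring;
          replace (y + h - y) with h in H by ring. }
    assert (Hkd : Rabs k < delta) by nra.
    assert (Hq := Hdelta k Hk0 Hkd); rewrite Fk, FG in Hq.
    replace (y + h - y) with h in Hq by ring.
    assert (Hfy := Hf (G y)).
    assert (Hkpos := Rabs_pos_lt k Hk0); assert (Hhpos := Rabs_pos_lt h Hh0).
    replace (k / h - / f (G y))
      with (- ((h / k - f (G y)) * (k / h) / f (G y)))
      by (field; repeat split; lra).
    rewrite Rabs_Ropp; unfold Rdiv at 1.
    rewrite Rabs_mult, Rabs_mult, Rabs_inv, (Rabs_pos_eq (f (G y))) by lra.
    assert (Hkh : Rabs (k / h) <= / m).
    { rewrite Rabs_div by exact Hh0.
      apply Rmult_le_reg_l with (m * Rabs h); [nra |].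
      replace (m * Rabs h * (Rabs k / Rabs h)) with (m * Rabs k)
        by (field; lra).
      replace (m * Rabs h * / m) with (Rabs h) by (field; lra); exact Hk. }
    assert (Hfm : / f (G y) <= / m) by (apply Rinv_le_contravar; lra).
    assert (Hi : 0 < / f (G y)) by (apply Rinv_0_lt_compat; lra).
    apply Rle_lt_trans with (Rabs (h / k - f (G y)) * / m * / m).
    + apply Rmult_le_compat; try lra;
        [apply Rmult_le_pos; apply Rabs_pos |].
      apply Rmult_le_compat_l; [apply Rabs_pos | exact Hkh].
    + apply Rmult_lt_reg_r with (m * m); [nra |].
      replace (Rabs (h / k - f (G y)) * / m * / m * (m * m))
        with (Rabs (h / k - f (G y))) by (field; lra).
      exact Hq.
Qed.

(** A class stable under differentiation contains all iterated derivatives of its members, so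
    higher-order product and chain rules are avoided. *)
Lemma smooth_of_closed_class (A : (R -> R) -> Prop) :
  (forall f, A f -> exists g, A g /\ forall s, is_derive f s (g s)) ->
  forall f, A f -> smooth f.
Proof.
  intros HA f Hf.
  assert (H : forall n, exists g, A g /\ forall s, Derive_n f n s = g s).
  { induction n as [ | n [g [Hg E]]]; [now exists f |].
    destruct (HA g Hg) as [h [Hh Hd]]; exists h; split; [exact Hh |].
    intros s; simpl; rewrite (Derive_ext _ g) by exact E.
    now apply is_derive_unique. }
  intros [ | n] s; simpl; [exact I |].
  destruct (H n) as [g [Hg E]]; destruct (HA g Hg) as [h [_ Hd]].
  apply ex_derive_ext with g; [intros; now rewrite E |].
  exists (h s); apply Hd.
Qed.

Lemma smooth_affine (a b : R) : smooth (fun s => a * s + b).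
Proof.
  apply smooth_of_closed_class
    with (fun f => exists a b, forall s, f s = a * s + b); [ | now exists a, b].
  intros f [a0 [b0 E]]; exists (fun _ => a0); split.
  - exists 0, a0; intros; ring.
  - intros s; apply is_derive_ext with (fun s => a0 * s + b0); [now symmetry |].
    auto_derive; [exact I | ring].
Qed.

(** * The reduced system: existence, uniqueness and symmetry *)

(** The initial values put the point closest to the origin at parameter 0 and position [i d], with
    horizontal tangent; this fixes the rotation and the shift of the parameter. *)
Record profile (B d : R) (tau nu theta : R -> R) : Prop := {
  tau_0 : tau 0 = 0;
  nu_0 : nu 0 = d;
  theta_0 : theta 0 = 0;
  tau_derive : forall s, is_derive tau s (1 + B * nu s ^ 2);
  nu_derive : forall s, is_derive nu s (- (B * tau s * nu s));
  theta_derive : forall s, is_derive theta s (B * nu s)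
}.

(** The factor in [tau] is moved to the right so that the left side is an increasing function of
    [nu] alone, ready to be inverted. *)
Lemma profile_first_integral (B d : R) (tau nu theta : R -> R) :
  profile B d tau nu theta ->
  forall s, nu s * exp (B * nu s ^ 2 / 2) =
            d * exp (B * d ^ 2 / 2) * exp (- (B * tau s ^ 2 / 2)).
Proof.
  intros P s.
  assert (E : nu s * exp (B * nu s ^ 2 / 2) * exp (B * tau s ^ 2 / 2)
              = d * exp (B * d ^ 2 / 2)).
  { transitivity (nu 0 * exp (B * nu 0 ^ 2 / 2) * exp (B * tau 0 ^ 2 / 2)).
    - apply (derivative_zero_constant
        (fun s => nu s * exp (B * nu s ^ 2 / 2) * exp (B * tau s ^ 2 / 2))).
      intros x.
      assert (Ht := tau_derive _ _ _ _ _ P x).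
      assert (Hn := nu_derive _ _ _ _ _ P x).
      auto_derive.
      + repeat (split; [eexists; eassumption |]); exact I.
      + apply is_derive_unique in Ht, Hn.
        change (Derive (fun x => tau x)) with (Derive tau).
        change (Derive (fun x => nu x)) with (Derive nu).
        rewrite Ht, Hn; field.
    - rewrite (tau_0 _ _ _ _ _ P), (nu_0 _ _ _ _ _ P).
      replace (B * 0 ^ 2 / 2) with 0 by field; rewrite exp_0; ring. }
  rewrite <- E, !Rmult_assoc, <- exp_plus.
  rewrite Rplus_opp_r, exp_0; ring.
Qed.

(* The level curves of the first integral are graphs [nu = V tau]. *)
Lemma support_function (B d : R) :
  0 < B -> 0 <= d ->
  exists V : R -> R,
    V 0 = d /\
    (forall t, 0 <= V t <= d) /\
    (forall t, is_derive V t (- (B * t * V t) / (1 + B * V t ^ 2))) /\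
    (forall t v, v * exp (B * v ^ 2 / 2) =
       d * exp (B * d ^ 2 / 2) * exp (- (B * t ^ 2 / 2)) -> v = V t).
Proof.
  intros HB Hd.
  set (F := fun v => v * exp (B * v ^ 2 / 2)).
  set (f := fun v => (1 + B * v ^ 2) * exp (B * v ^ 2 / 2)).
  assert (HF : forall v, is_derive F v (f v)).
  { intros v; unfold F, f; auto_derive; [exact I | simpl; unfold Rdiv; field]. }
  assert (Hexp : forall v, 1 <= exp (B * v ^ 2 / 2)).
  { intros v; assert (H := exp_ineq1_le (B * v ^ 2 / 2)).
    assert (0 <= B * v ^ 2 / 2) by nra; lra. }
  assert (Hf : forall v, 1 <= f v).
  { intros v; unfold f; assert (H := Hexp v).
    assert (0 <= B * v ^ 2) by nra; nra. }
  destruct (inverse_function F f 1 Rlt_0_1 HF Hf) as [G [GF [FG HG]]].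
  set (c := fun t => F d * exp (- (B * t ^ 2 / 2))).
  assert (Hmono : forall a b, F a <= F b -> a <= b).
  { intros a b H; destruct (Rle_dec a b) as [ | N]; [assumption |].
    assert (K := derivative_lower_bound F f 1 b a HF ltac:(lra)
                   ltac:(intros; apply Hf)); lra. }
  assert (HFd : 0 <= F d) by (unfold F; assert (H := Hexp d); nra).
  exists (fun t => G (c t)); split; [ | split; [intros t; split |]; [ | | split]].
  - replace (c 0) with (F d); [apply GF |].
    unfold c; replace (- (B * 0 ^ 2 / 2)) with 0 by field.
    rewrite exp_0; ring.
  - apply Hmono; rewrite FG; unfold F at 1; rewrite Rmult_0_l.
    unfold c; apply Rmult_le_pos; [exact HFd | left; apply exp_pos].
  - apply Hmono; rewrite FG; unfold c.
    rewrite <- (Rmult_1_r (F d)) at 2; apply Rmult_le_compat_l; [exact HFd |].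
    rewrite <- exp_0; destruct (Req_dec t 0) as [-> | Ht].
    + right; f_equal; field.
    + left; apply exp_increasing; assert (0 < t * t) by nra; nra.
  - intros t.
    assert (Hc : is_derive c t (- (B * t) * c t)).
    { unfold c; auto_derive; [exact I | simpl; unfold Rdiv; field]. }
    replace (- (B * t * G (c t)) / (1 + B * G (c t) ^ 2))
      with (scal (- (B * t) * c t) (/ f (G (c t)))).
    + apply (is_derive_comp G c); [apply HG | exact Hc].
    (* Writing [c t] as [F (G (c t))] makes the exponentials in [F / f] cancel and leaves
       [v / (1 + B v^2)] with [v = G (c t)]. *)
    + rewrite <- (FG (c t)) at 1; unfold scal; simpl; unfold mult; simpl.
      unfold F, f; field.
      split; [ | apply Rgt_not_eq, exp_pos].
      assert (0 <= B * G (c t) ^ 2) by nra; simpl in *; lra.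
  - intros t v E; rewrite <- (GF v); f_equal; exact E.
Qed.

(* Along [nu = V tau] the system reduces to [tau' = 1 + B (V tau)^2], which is
   solved by inverting the primitive [S] of [1 / (1 + B V^2)]. *)
Lemma arclength_of_tau (B d : R) :
  0 < B -> 0 <= d ->
  exists V S T : R -> R,
    V 0 = d /\ S 0 = 0 /\
    (forall t v, v * exp (B * v ^ 2 / 2) =
       d * exp (B * d ^ 2 / 2) * exp (- (B * t ^ 2 / 2)) -> v = V t) /\
    (forall t, is_derive V t (- (B * t * V t) / (1 + B * V t ^ 2))) /\
    (forall t, is_derive S t (/ (1 + B * V t ^ 2))) /\
    (forall t, T (S t) = t) /\
    (forall s, is_derive T s (1 + B * V (T s) ^ 2)).
Proof.
  intros HB Hd.
  destruct (support_function B d HB Hd) as [V [V0 [HV [HV' Huniq]]]].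
  assert (Hpos : forall t, 0 < 1 + B * V t ^ 2).
  { intros t; assert (0 <= B * V t ^ 2) by nra; lra. }
  destruct (continuous_primitive (fun t => / (1 + B * V t ^ 2)) 0)
    as [S [S0 HS]].
  { intros t; auto_derive; split; [eexists; apply HV' |].
    split; [assert (H := Hpos t); simpl in H; lra | exact I]. }
  (* The uniform lower bound on the slope of [S] comes from [V <= d]. *)
  destruct (inverse_function S (fun t => / (1 + B * V t ^ 2))
              (/ (1 + B * d ^ 2))) as [T [TS [ST HT]]].
  - apply Rinv_0_lt_compat; assert (0 <= B * d ^ 2) by nra; lra.
  - exact HS.
  - intros t; apply Rinv_le_contravar; [apply Hpos |].
    assert (H := HV t); assert (V t ^ 2 <= d ^ 2) by nra; nra.
  - exists V, S, T; do 6 (split; [eassumption |]).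
    intros s; rewrite <- (Rinv_inv (1 + B * V (T s) ^ 2)); apply HT.
Qed.

Lemma profile_exists (B d : R) :
  0 < B -> 0 <= d -> exists tau nu theta, profile B d tau nu theta.
Proof.
  intros HB Hd.
  destruct (arclength_of_tau B d HB Hd)
    as [V [S [T [V0 [S0 [_ [HV [_ [TS HT]]]]]]]]].
  assert (T0 : T 0 = 0) by (rewrite <- S0 at 1; apply TS).
  assert (HVT : forall s, is_derive (fun s => V (T s)) s (- (B * T s * V (T s)))).
  { intros s; replace (- (B * T s * V (T s))) with
      (scal (1 + B * V (T s) ^ 2)
            (- (B * T s * V (T s)) / (1 + B * V (T s) ^ 2))).
    - apply (is_derive_comp V T); [apply HV | apply HT].
    - unfold scal; simpl; unfold mult; simpl; field.
      assert (0 <= B * V (T s) ^ 2) by nra; simpl in *; lra. }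
  destruct (continuous_primitive (fun s => B * V (T s)) 0) as [theta [t0 Ht]].
  { intros s; apply (ex_derive_scal (fun s => V (T s))); eexists; apply HVT. }
  exists T, (fun s => V (T s)), theta; constructor; auto.
  now rewrite T0.
Qed.

(** The first integral forces [nu = V tau]. Then [S (tau s) - s] has zero derivative, so [tau] is
    the inverse [T] of [S]; the two angles have equal derivatives and initial values. *)
Lemma profile_unique (B d : R) (t1 n1 a1 t2 n2 a2 : R -> R) :
  0 < B -> 0 <= d -> profile B d t1 n1 a1 -> profile B d t2 n2 a2 ->
  forall s, t1 s = t2 s /\ n1 s = n2 s /\ a1 s = a2 s.
Proof.
  intros HB Hd P1 P2.
  destruct (arclength_of_tau B d HB Hd)
    as [V [S [T [V0 [S0 [Huniq [HV [HS [TS _]]]]]]]]].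
  assert (Hsol : forall t n a, profile B d t n a ->
            forall s, t s = T s /\ n s = V (T s)).
  { intros t n a P.
    assert (Hn : forall s, n s = V (t s)).
    { intros s; apply Huniq, (profile_first_integral _ _ _ _ _ P). }
    assert (Ht : forall s, S (t s) = s).
    { intros s.
      assert (E : S (t s) - s = S (t 0) - 0).
      { apply (derivative_zero_constant (fun s => S (t s) - s)); intros x.
        replace 0 with
          (minus (scal (1 + B * n x ^ 2) (/ (1 + B * V (t x) ^ 2))) 1).
        - apply (is_derive_minus (fun s => S (t s)) (fun s => s)).
          + apply (is_derive_comp S t);
              [apply HS | apply (tau_derive _ _ _ _ _ P)].
          + apply is_derive_Reals, derivable_pt_lim_id.
        - rewrite <- Hn.
          unfold minus, plus, opp, scal; simpl; unfold mult; simpl.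
          field; assert (0 <= B * n x ^ 2) by nra; simpl in *; lra. }
      rewrite (tau_0 _ _ _ _ _ P), S0 in E; lra. }
    assert (tT : forall s, t s = T s) by (intros s; rewrite <- (Ht s) at 2; now rewrite TS).
    intros s; split; [apply tT |]; rewrite Hn; now rewrite tT. }
  intros s; destruct (Hsol _ _ _ P1 s) as [-> ->];
    destruct (Hsol _ _ _ P2 s) as [-> ->]; repeat split.
  assert (E : a1 s - a2 s = a1 0 - a2 0).
  { apply (derivative_zero_constant (fun s => a1 s - a2 s)); intros x.
    replace 0 with (minus (B * n1 x) (B * n2 x)).
    - apply (is_derive_minus a1 a2);
        [apply (theta_derive _ _ _ _ _ P1) | apply (theta_derive _ _ _ _ _ P2)].
    - destruct (Hsol _ _ _ P1 x) as [_ ->]; destruct (Hsol _ _ _ P2 x) as [_ ->].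
      unfold minus, plus, opp; simpl; ring. }
  rewrite (theta_0 _ _ _ _ _ P1), (theta_0 _ _ _ _ _ P2) in E; lra.
Qed.

Lemma profile_nu_nonneg (B d : R) (tau nu theta : R -> R) :
  0 <= d -> profile B d tau nu theta -> forall s, 0 <= nu s.
Proof.
  intros Hd P s.
  assert (E := profile_first_integral _ _ _ _ _ P s).
  assert (H1 := exp_pos (B * nu s ^ 2 / 2)).
  assert (H2 : 0 <= nu s * exp (B * nu s ^ 2 / 2)).
  { rewrite E; repeat apply Rmult_le_pos;
      [exact Hd | left; apply exp_pos | left; apply exp_pos]. }
  nra.
Qed.

Lemma profile_nu_pos (B d : R) (tau nu theta : R -> R) :
  0 < d -> profile B d tau nu theta -> forall s, 0 < nu s.
Proof.
  intros Hd P s.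
  assert (E := profile_first_integral _ _ _ _ _ P s).
  assert (H1 := exp_pos (B * nu s ^ 2 / 2)).
  assert (H2 : 0 < nu s * exp (B * nu s ^ 2 / 2)).
  { rewrite E; repeat apply Rmult_lt_0_compat;
      [exact Hd | apply exp_pos | apply exp_pos]. }
  nra.
Qed.

Lemma profile_nu_zero (B : R) (tau nu theta : R -> R) :
  profile B 0 tau nu theta -> forall s, nu s = 0.
Proof.
  intros P s.
  assert (E := profile_first_integral _ _ _ _ _ P s).
  assert (H1 := exp_pos (B * nu s ^ 2 / 2)); nra.
Qed.

(** The system and its initial values are preserved when [s] is replaced by [- s] and the signs of
    [tau] and [theta] are changed, so uniqueness applies. *)
Lemma profile_reflect (B d : R) (tau nu theta : R -> R) :
  0 < B -> 0 <= d -> profile B d tau nu theta ->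
  forall s, tau (- s) = - tau s /\ nu (- s) = nu s /\ theta (- s) = - theta s.
Proof.
  intros HB Hd P.
  assert (Hopp : forall f s l, is_derive f (- s) l ->
            is_derive (fun s => f (- s)) s (- l)).
  { intros f s l H; replace (- l) with (scal (-1) l)
      by (unfold scal; simpl; unfold mult; simpl; ring).
    apply (is_derive_comp f Ropp); [exact H |].
    auto_derive; [exact I | ring]. }
  assert (P' : profile B d (fun s => - tau (- s)) (fun s => nu (- s))
                 (fun s => - theta (- s))).
  { constructor.
    - rewrite Ropp_0, (tau_0 _ _ _ _ _ P); ring.
    - rewrite Ropp_0; apply (nu_0 _ _ _ _ _ P).
    - rewrite Ropp_0, (theta_0 _ _ _ _ _ P); ring.
    - intros s; rewrite <- Ropp_involutive.
      apply (is_derive_opp (fun s => tau (- s))), Hopp, (tau_derive _ _ _ _ _ P).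
    - intros s; replace (- (B * - tau (- s) * nu (- s)))
        with (- - (B * tau (- s) * nu (- s))) by ring.
      apply Hopp, (nu_derive _ _ _ _ _ P).
    - intros s; rewrite <- Ropp_involutive.
      apply (is_derive_opp (fun s => theta (- s))), Hopp,
        (theta_derive _ _ _ _ _ P). }
  intros s.
  destruct (profile_unique _ _ _ _ _ _ _ _ HB Hd P P' (- s)) as [E1 [E2 E3]].
  rewrite Ropp_involutive in E1, E2, E3; auto.
Qed.

(** * Growth, limiting angle and decay of a profile *)

Lemma profile_tau_ge (B d : R) (tau nu theta : R -> R) :
  0 < B -> profile B d tau nu theta -> forall s, 0 <= s -> s <= tau s.
Proof.
  intros HB P s Hs.
  assert (H := derivative_lower_bound tau _ 1 0 s (tau_derive _ _ _ _ _ P) Hs).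
  rewrite (tau_0 _ _ _ _ _ P) in H.
  assert (1 * (s - 0) <= tau s - 0); [ | lra].
  apply H; intros x _; assert (0 <= B * nu x ^ 2) by nra; lra.
Qed.

Lemma profile_tau_abs_ge (B d : R) (tau nu theta : R -> R) :
  0 < B -> 0 <= d -> profile B d tau nu theta ->
  forall s, Rabs s <= Rabs (tau s).
Proof.
  intros HB Hd P s.
  assert (H : forall s, 0 <= s -> Rabs s <= Rabs (tau s)).
  { intros r Hr; assert (K := profile_tau_ge _ _ _ _ _ HB P r Hr).
    rewrite !Rabs_pos_eq; lra. }
  destruct (Rle_dec 0 s) as [Hs | Hs]; [now apply H |].
  rewrite <- Rabs_Ropp, <- (Rabs_Ropp (tau s)).
  destruct (profile_reflect _ _ _ _ _ HB Hd P s) as [<- _]; apply H; lra.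
Qed.

Lemma profile_theta_increasing (B d : R) (tau nu theta : R -> R) :
  0 < B -> 0 <= d -> profile B d tau nu theta ->
  forall s r, s <= r -> theta s <= theta r.
Proof.
  intros HB Hd P s r Hsr.
  assert (H := derivative_lower_bound theta _ 0 s r
                 (theta_derive _ _ _ _ _ P) Hsr).
  assert (0 * (r - s) <= theta r - theta s); [ | lra].
  apply H; intros x _.
  assert (K := profile_nu_nonneg _ _ _ _ _ Hd P x); nra.
Qed.

(* [atan (tau / nu) - theta] is, up to a constant, minus the polar angle of
   the curve; the curve runs clockwise around the origin while its tangent
   turns counterclockwise. *)
Lemma profile_angle_bound (B d : R) (tau nu theta : R -> R) :
  0 < B -> 0 <= d -> profile B d tau nu theta ->
  exists b, 0 <= b < PI / 2 /\ forall s, 0 <= s -> theta s <= b.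
Proof.
  intros HB Hd P; assert (HPI := PI_RGT_0).
  (* For [d = 0] the quotient [tau / nu] degenerates, but then [nu] vanishes identically and [theta]
     stays 0. *)
  destruct (Req_dec d 0) as [-> | Hd0].
  { exists 0; split; [lra |]; intros s _.
    rewrite <- (theta_0 _ _ _ _ _ P); right.
    apply derivative_zero_constant; intros x.
    replace 0 with (B * nu x);
      [apply (theta_derive _ _ _ _ _ P) |].
    rewrite (profile_nu_zero _ _ _ _ P); ring. }
  assert (Hdpos : 0 < d) by lra.
  assert (Hnu := profile_nu_pos _ _ _ _ _ Hdpos P).
  set (w := fun s => atan (tau s / nu s) - theta s).
  assert (Hw : forall s, is_derive w s (nu s / (tau s ^ 2 + nu s ^ 2))).
  { intros s; assert (Hn := Hnu s).
    replace (nu s / (tau s ^ 2 + nu s ^ 2)) with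
      (minus (scal (((1 + B * nu s ^ 2) * nu s
                      - tau s * (- (B * tau s * nu s))) / nu s ^ 2)
                   (/ (1 + Rsqr (tau s / nu s)))) (B * nu s)).
    - apply (is_derive_minus (fun s => atan (tau s / nu s)) theta);
        [ | apply (theta_derive _ _ _ _ _ P)].
      apply (is_derive_comp atan (fun s => tau s / nu s));
        [apply is_derive_atan |].
      apply is_derive_div; [apply (tau_derive _ _ _ _ _ P)
        | apply (nu_derive _ _ _ _ _ P) | lra].
    - unfold minus, plus, opp, scal; simpl; unfold mult; simpl.
      unfold Rsqr; field; nra. }
  assert (Hw' : forall s, 0 < nu s / (tau s ^ 2 + nu s ^ 2)).
  { intros s; assert (H := Hnu s).
    apply Rdiv_lt_0_compat; [exact H | nra]. }
  assert (w0 : w 0 = 0).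
  { unfold w; rewrite (tau_0 _ _ _ _ _ P), (theta_0 _ _ _ _ _ P).
    unfold Rdiv; rewrite Rmult_0_l, atan_0; ring. }
  (* This is the source of the strict bound: [w] starts at 0 and increases, so from time 1 on it is
     at least [w 1 > 0], while [atan] stays below [PI / 2]. Any positive time would serve. *)
  assert (w1 : 0 < w 1).
  { rewrite <- w0; apply (derivative_pos_increasing w _ 0 1 Hw); [lra | auto]. }
  assert (w1' : forall s, 1 <= s -> w 1 <= w s).
  { intros s Hs.
    assert (H := derivative_lower_bound w _ 0 1 s Hw Hs
                   ltac:(intros; left; apply Hw')); lra. }
  assert (Ht : forall s, 1 <= s -> theta s <= PI / 2 - w 1).
  { intros s Hs; assert (H := w1' s Hs); unfold w in H at 2.
    assert (K := atan_bound (tau s / nu s)); lra. }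
  assert (H1 := Ht 1 (Rle_refl 1)).
  assert (H0 := profile_theta_increasing _ _ _ _ _ HB Hd P).
  assert (H01 := H0 0 1 Rle_0_1); rewrite (theta_0 _ _ _ _ _ P) in H01.
  exists (PI / 2 - w 1); split; [lra |].
  intros s Hs; destruct (Rle_dec 1 s) as [H | H]; [now apply Ht |].
  specialize (H0 s 1 ltac:(lra)); lra.
Qed.

(** [L] is the supremum of [theta] over nonnegative parameters, and oddness of [theta] extends the
    bound to all of them. The rate holds because [theta + nu] does not increase once [tau >= 1],
    which [s >= 1] guarantees. *)
Lemma profile_limit_angle (B d : R) (tau nu theta : R -> R) :
  0 < B -> 0 <= d -> profile B d tau nu theta ->
  exists L, 0 <= L < PI / 2 /\ (forall s, Rabs (theta s) <= L) /\
    forall s, 1 <= s -> L - theta s <= nu s.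
Proof.
  intros HB Hd P.
  destruct (profile_angle_bound _ _ _ _ _ HB Hd P) as [b [Hb Hbs]].
  assert (Hmono := profile_theta_increasing _ _ _ _ _ HB Hd P).
  destruct (completeness (fun v => exists s, 0 <= s /\ v = theta s))
    as [L [HL1 HL2]].
  { exists b; intros v [s [Hs ->]]; auto. }
  { exists (theta 0), 0; lra. }
  assert (HL : forall s, 0 <= s -> theta s <= L)
    by (intros s Hs; apply HL1; now exists s).
  assert (HLb : L <= b) by (apply HL2; intros v [s [Hs ->]]; auto).
  assert (H0 : 0 <= L) by (rewrite <- (theta_0 _ _ _ _ _ P); apply HL; lra).
  exists L; split; [lra | split].
  - assert (Habs : forall s, 0 <= s -> Rabs (theta s) <= L).
    { intros s Hs; rewrite Rabs_pos_eq; [auto |].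
      rewrite <- (theta_0 _ _ _ _ _ P); auto. }
    intros s; destruct (Rle_dec 0 s) as [Hs | Hs]; [auto |].
    rewrite <- Rabs_Ropp.
    destruct (profile_reflect _ _ _ _ _ HB Hd P s) as [_ [_ <-]].
    apply Habs; lra.
  - intros s Hs.
    (* Since [L] is a least upper bound, it suffices that [theta s + nu s] bounds every later and
       earlier value of [theta]. *)
    assert (HLs : L <= theta s + nu s); [ | lra].
    assert (Hn := profile_nu_nonneg _ _ _ _ _ Hd P).
    apply HL2; intros v [r [Hr ->]].
    destruct (Rle_dec r s) as [Hrs | Hrs].
    { specialize (Hmono r s Hrs); specialize (Hn s); lra. }
    (* [theta' = B nu <= B tau nu = - nu'] as soon as [tau >= 1]. *)
    assert (0 * (r - s) <= - (theta r + nu r) - - (theta s + nu s)).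
    { apply (derivative_lower_bound (fun s => - (theta s + nu s))
               (fun x => - (B * nu x + - (B * tau x * nu x)))); [ | lra |].
      - intros x; apply (is_derive_opp (fun s => theta s + nu s)).
        apply (is_derive_plus theta nu); [apply (theta_derive _ _ _ _ _ P)
          | apply (nu_derive _ _ _ _ _ P)].
      - intros x Hx.
        assert (Hx1 := profile_tau_ge _ _ _ _ _ HB P x ltac:(lra)).
        assert (0 <= B * nu x * (tau x - 1)); [ | lra].
        apply Rmult_le_pos; [ | lra].
        apply Rmult_le_pos; [lra | apply Hn]. }
    specialize (Hn r); lra.
Qed.

(** The product [nu * (1 + tau)] is what bounds the distance to the ray. The Gaussian decay is
    weakened by [x <= exp x], where [x = B tau^2 / 2]; together with [1 + tau <= 2 tau] and
    [s <= tau] this produces the constant [4 * c / B]. *)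
Lemma profile_decay (B d : R) (tau nu theta : R -> R) :
  0 < B -> 0 <= d -> profile B d tau nu theta ->
  exists K, forall s, 1 <= s -> nu s * (1 + tau s) <= K / s.
Proof.
  intros HB Hd P; set (c := d * exp (B * d ^ 2 / 2)).
  exists (4 * c / B); intros s Hs.
  assert (Ht := profile_tau_ge _ _ _ _ _ HB P s ltac:(lra)).
  assert (Hn := profile_nu_nonneg _ _ _ _ _ Hd P s).
  assert (E := profile_first_integral _ _ _ _ _ P s); fold c in E.
  set (x := B * tau s ^ 2 / 2) in *.
  assert (Hx : 0 <= x) by (unfold x; nra).
  assert (H1 : nu s * exp x <= c).
  { assert (H := exp_ineq1_le (B * nu s ^ 2 / 2)).
    assert (0 <= B * nu s ^ 2 / 2) by nra.
    assert (H2 : nu s * 1 <= c * exp (- x))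
      by (rewrite <- E; apply Rmult_le_compat_l; lra).
    assert (H3 := exp_pos x).
    apply Rle_trans with (c * exp (- x) * exp x).
    - apply Rmult_le_compat_r; lra.
    - rewrite Rmult_assoc, <- exp_plus, Rplus_opp_l, exp_0; lra. }
  assert (H2 : nu s * x <= c).
  { apply Rle_trans with (nu s * exp x); [ | exact H1].
    apply Rmult_le_compat_l; [exact Hn |].
    assert (H := exp_ineq1_le x); lra. }
  apply Rmult_le_reg_r with (B * s); [nra |].
  replace (4 * c / B / s * (B * s)) with (4 * c) by (field; lra).
  apply Rle_trans with (4 * (nu s * x)); [ | lra].
  replace (4 * (nu s * x)) with (nu s * (2 * tau s) * (B * tau s))
    by (unfold x; field).
  apply Rmult_le_compat; [apply Rmult_le_pos; lra | nra | | nra].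
  apply Rmult_le_compat_l; lra.
Qed.

(** The cubic terms cancel in the derivative of the squared distance, which is [2 * tau]. Hence the
    distance grows away from the zero of [tau]. *)
Lemma profile_norm_ge (B d : R) (tau nu theta : R -> R) :
  0 < B -> 0 <= d -> profile B d tau nu theta ->
  forall s, d ^ 2 <= tau s ^ 2 + nu s ^ 2.
Proof.
  intros HB Hd P.
  assert (Hf : forall x, is_derive (fun s => tau s ^ 2 + nu s ^ 2) x
                           (2 * tau x)).
  { intros x.
    assert (Ht := tau_derive _ _ _ _ _ P x).
    assert (Hn := nu_derive _ _ _ _ _ P x).
    replace (2 * tau x) with
      (plus (INR 2 * (1 + B * nu x ^ 2) * tau x ^ 1)
            (INR 2 * - (B * tau x * nu x) * nu x ^ 1))
      by (unfold plus; simpl; ring).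
    apply (is_derive_plus (fun s => tau s ^ 2) (fun s => nu s ^ 2));
      now apply (is_derive_pow _ 2). }
  assert (H : forall s, 0 <= s -> d ^ 2 <= tau s ^ 2 + nu s ^ 2).
  { intros s Hs.
    assert (H := derivative_lower_bound _ _ 0 0 s Hf Hs).
    simpl in H; rewrite (tau_0 _ _ _ _ _ P), (nu_0 _ _ _ _ _ P) in H.
    assert (K : forall x, 0 <= x <= s -> 0 <= 2 * tau x).
    { intros x [Hx _].
      assert (L := profile_tau_ge _ _ _ _ _ HB P x Hx); lra. }
    specialize (H K); simpl; lra. }
  intros s; destruct (Rle_dec 0 s) as [Hs | Hs]; [auto |].
  destruct (profile_reflect _ _ _ _ _ HB Hd P s) as [E1 [E2 _]].
  specialize (H (- s) ltac:(lra)); rewrite E1, E2 in H.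
  replace ((- tau s) ^ 2) with (tau s ^ 2) in H by ring; exact H.
Qed.

(** * From profiles to expanders *)

(* [(tau + i nu) e^{i theta}] *)
Definition model (tau nu theta : R -> R) (s : R) : C :=
  (tau s * cos (theta s) - nu s * sin (theta s),
   tau s * sin (theta s) + nu s * cos (theta s)).

(** In the moving frame the velocity has components [tau' - nu theta' = 1] and
    [nu' + tau theta' = 0], so it is [e^{i theta}]. *)
Lemma model_derive (B d : R) (tau nu theta : R -> R) :
  profile B d tau nu theta ->
  forall s,
    is_derive (fun s => Re (model tau nu theta s)) s (cos (theta s)) /\
    is_derive (fun s => Im (model tau nu theta s)) s (sin (theta s)).
Proof.
  intros P s.
  assert (Ht := tau_derive _ _ _ _ _ P s).
  assert (Hn := nu_derive _ _ _ _ _ P s).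
  assert (Ha := theta_derive _ _ _ _ _ P s).
  split; simpl; auto_derive.
  1, 3: repeat (split; [eexists; eassumption |]); exact I.
  all: apply is_derive_unique in Ht, Hn, Ha;
    change (Derive (fun x => tau x)) with (Derive tau);
    change (Derive (fun x => nu x)) with (Derive nu);
    change (Derive (fun x => theta x)) with (Derive theta);
    rewrite Ht, Hn, Ha; ring.
Qed.

(** The real algebra generated by [G]. By the Leibniz rule it is stable under differentiation as
    soon as the derivatives of the generators lie in it. *)
Inductive polynomial_in (G : (R -> R) -> Prop) : (R -> R) -> Prop :=
  | poly_gen (f : R -> R) : G f -> polynomial_in G f
  | poly_const (c : R) : polynomial_in G (fun _ => c)
  | poly_add (f g : R -> R) :
      polynomial_in G f -> polynomial_in G g ->
      polynomial_in G (fun s => f s + g s)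
  | poly_mul (f g : R -> R) :
      polynomial_in G f -> polynomial_in G g ->
      polynomial_in G (fun s => f s * g s).

Lemma polynomial_in_smooth (G : (R -> R) -> Prop) :
  (forall f, G f ->
     exists g, polynomial_in G g /\ forall s, is_derive f s (g s)) ->
  forall f, polynomial_in G f -> smooth f.
Proof.
  intros HG; apply smooth_of_closed_class; intros f Hf.
  induction Hf as [f Hf | c | f g Hf [f' [Af Df]] Hg [g' [Ag Dg]]
                  | f g Hf [f' [Af Df]] Hg [g' [Ag Dg]]].
  - auto.
  - exists (fun _ => 0); split; [apply poly_const |].
    intros s; apply (is_derive_const c).
  - exists (fun s => f' s + g' s); split; [now apply poly_add |].
    intros s; now apply (is_derive_plus f g).
  - exists (fun s => f' s * g s + f s * g' s); split.
    + apply poly_add; now apply poly_mul.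
    + intros s; apply (is_derive_mult f g); auto; intros; apply Rmult_comm.
Qed.

(** The angle enters only through its cosine and sine, and the derivatives of [tau], [nu],
    [cos theta] and [sin theta] are polynomials in these four functions. *)
Lemma model_smooth (B d : R) (tau nu theta : R -> R) :
  profile B d tau nu theta -> smooth_curve (model tau nu theta).
Proof.
  intros P.
  set (G := fun f : R -> R => f = tau \/ f = nu \/
              f = (fun s => cos (theta s)) \/ f = (fun s => sin (theta s))).
  assert (Gt : polynomial_in G tau) by (apply poly_gen; red; auto).
  assert (Gn : polynomial_in G nu) by (apply poly_gen; red; auto).
  assert (Gc : polynomial_in G (fun s => cos (theta s)))
    by (apply poly_gen; red; auto).
  assert (Gs : polynomial_in G (fun s => sin (theta s)))
    by (apply poly_gen; red; auto).
  assert (HG : forall f, polynomial_in G f -> smooth f).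
  { apply polynomial_in_smooth; intros f [-> | [-> | [-> | ->]]].
    - exists (fun s => 1 + B * (nu s * nu s)); split.
      + apply poly_add; [apply poly_const |].
        apply poly_mul; [apply poly_const | now apply poly_mul].
      + intros s; replace (nu s * nu s) with (nu s ^ 2) by ring.
        apply (tau_derive _ _ _ _ _ P).
    - exists (fun s => (- B) * (tau s * nu s)); split.
      + apply poly_mul; [apply poly_const | now apply poly_mul].
      + intros s; replace (- B * (tau s * nu s)) with (- (B * tau s * nu s))
          by ring.
        apply (nu_derive _ _ _ _ _ P).
    - exists (fun s => (B * nu s) * (-1 * sin (theta s))); split.
      + apply poly_mul; apply poly_mul; auto; apply poly_const.
      + intros s; replace (-1 * sin (theta s)) with (- sin (theta s)) by ring.
        apply (is_derive_comp cos theta);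
          [apply is_derive_cos | apply (theta_derive _ _ _ _ _ P)].
    - exists (fun s => (B * nu s) * cos (theta s)); split.
      + apply poly_mul; [apply poly_mul | ]; auto; apply poly_const.
      + intros s; apply (is_derive_comp sin theta);
          [apply is_derive_sin | apply (theta_derive _ _ _ _ _ P)]. }
  split; intros n s.
  - apply (ex_derive_n_ext
      (fun s => tau s * cos (theta s) + -1 * (nu s * sin (theta s)))).
    + intros r; simpl; ring.
    + apply HG, poly_add; [now apply poly_mul |].
      apply poly_mul; [apply poly_const | now apply poly_mul].
  - apply HG, (poly_add G (fun s => tau s * sin (theta s))
                 (fun s => nu s * cos (theta s))); now apply poly_mul.
Qed.

(** For a curve with velocity [e^{i theta}] the curvature is [theta'], and the normal component of
    the position is [nu]; the expander equation is thus [theta' = B nu]. *)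
Lemma model_expander (B d : R) (tau nu theta : R -> R) :
  profile B d tau nu theta -> expander B (model tau nu theta).
Proof.
  intros P.
  assert (HM : forall s, vderiv (model tau nu theta) s
                         = (cos (theta s), sin (theta s))).
  { intros s; destruct (model_derive _ _ _ _ _ P s) as [H1 H2].
    unfold vderiv; f_equal; now apply is_derive_unique. }
  assert (HA : arclength_curve (model tau nu theta)).
  { split; [apply (model_smooth _ _ _ _ _ P) |].
    intros s; rewrite HM; unfold Cmod; simpl.
    replace (_ + _) with (Rsqr (sin (theta s)) + Rsqr (cos (theta s)))
      by (unfold Rsqr; ring).
    now rewrite sin2_cos2, sqrt_1. }
  split; [exact HA |]; intros s.
  rewrite (curvature_arclength _ _ HA).
  unfold normal; rewrite (tangent_arclength _ _ HA), HM.
  assert (H1 : vderiv (vderiv (model tau nu theta)) s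
               = (- (B * nu s * sin (theta s)), B * nu s * cos (theta s))).
  { assert (Ha := theta_derive _ _ _ _ _ P s).
    unfold vderiv at 1; f_equal; apply is_derive_unique.
    - apply is_derive_ext with (fun s => cos (theta s));
        [intros t; now rewrite HM |].
      replace (- (B * nu s * sin (theta s)))
        with (scal (B * nu s) (- sin (theta s)))
        by (unfold scal; simpl; unfold mult; simpl; ring).
      apply (is_derive_comp cos theta); [apply is_derive_cos | exact Ha].
    - apply is_derive_ext with (fun s => sin (theta s));
        [intros t; now rewrite HM |].
      apply (is_derive_comp sin theta); [apply is_derive_sin | exact Ha]. }
  rewrite H1; unfold inner, model; simpl.
  ring.
Qed.

(** * Rotations and the normal form of an expander *)

Lemma expi_add (a b : R) : Cmult (expi a) (expi b) = expi (a + b).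
Proof.
  unfold expi, Cmult; simpl; rewrite cos_plus, sin_plus; f_equal; ring.
Qed.

Lemma expi_cancel (a : R) (z : C) : Cmult (expi (- a)) (Cmult (expi a) z) = z.
Proof.
  rewrite Cmult_assoc, expi_add, Rplus_opp_l.
  unfold expi; rewrite cos_0, sin_0; apply Cmult_1_l.
Qed.

Lemma Cmod_expi (a : R) : Cmod (expi a) = 1.
Proof.
  unfold Cmod, expi; simpl.
  replace (_ + _) with (Rsqr (sin a) + Rsqr (cos a)) by (unfold Rsqr; ring).
  now rewrite sin2_cos2, sqrt_1.
Qed.

Lemma Cmod_sqr_eq (z : C) (m : R) :
  0 <= m -> (Cmod z = m <-> fst z ^ 2 + snd z ^ 2 = m ^ 2).
Proof.
  intros Hm; unfold Cmod; split; intros H.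
  - rewrite <- H, pow2_sqrt; [reflexivity | nra].
  - rewrite H; now apply sqrt_pow2.
Qed.

Lemma unit_vector_angle (u v : R) :
  u ^ 2 + v ^ 2 = 1 -> exists b, u = cos b /\ v = sin b.
Proof.
  intros H.
  assert (Hu : -1 <= u <= 1) by nra.
  assert (Hs : sin (acos u) ^ 2 = v ^ 2).
  { rewrite sin_acos by exact Hu; rewrite pow2_sqrt; unfold Rsqr; nra. }
  assert (Hp : 0 <= sin (acos u)).
  { rewrite sin_acos by exact Hu; apply sqrt_pos. }
  destruct (Rle_dec 0 v) as [Hv | Hv].
  - exists (acos u); rewrite cos_acos by exact Hu; split; [reflexivity | nra].
  - exists (- acos u); rewrite cos_neg, sin_neg, cos_acos by exact Hu.
    split; [reflexivity | nra].
Qed.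

(** [eps] is 1 or -1 and records the direction of travel; [s0] is the parameter of the closest
    point. *)
Definition placed (beta eps s0 : R) (M : R -> C) (s : R) : C :=
  Cmult (expi beta) (M (eps * (s - s0))).

(** These are the Frenet equations [T' = k N] in coordinates, with [k] replaced by [B <X, N>]. Unit
    speed makes [T'] orthogonal to [T = (p, q)], so its normal component, the curvature, determines
    it. *)
Lemma expander_frame (B : R) (X : R -> C) :
  expander B X ->
  exists p q : R -> R,
    let x s := Re (X s) in
    let y s := Im (X s) in
    let k s := B * (y s * p s - x s * q s) in
    (forall s, is_derive x s (p s)) /\ (forall s, is_derive y s (q s)) /\
    (forall s, p s ^ 2 + q s ^ 2 = 1) /\
    (forall s, is_derive p s (- (k s * q s))) /\
    (forall s, is_derive q s (k s * p s)).
Proof.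
  intros [HA HE]; destruct (HA) as [[Hx Hy] Hunit].
  exists (Derive (fun s => Re (X s))), (Derive (fun s => Im (X s))); simpl.
  set (p := Derive (fun s => Re (X s))); set (q := Derive (fun s => Im (X s))).
  assert (Hpq : forall s, p s ^ 2 + q s ^ 2 = 1).
  { intros s; assert (H := Hunit s); apply Cmod_sqr_eq in H; [ | lra].
    rewrite pow1 in H; exact H. }
  assert (Hp : forall s, is_derive p s (Derive p s))
    by (intros s; apply Derive_correct, (Hx 2%nat)).
  assert (Hq : forall s, is_derive q s (Derive q s))
    by (intros s; apply Derive_correct, (Hy 2%nat)).
  assert (Horth : forall s, p s * Derive p s + q s * Derive q s = 0).
  { intros s.
    assert (H : is_derive (fun s => p s ^ 2 + q s ^ 2) s
              (plus (INR 2 * Derive p s * p s ^ 1)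
                    (INR 2 * Derive q s * q s ^ 1))).
    { apply (is_derive_plus (fun s => p s ^ 2) (fun s => q s ^ 2));
        now apply (is_derive_pow _ 2). }
    apply is_derive_unique in H; unfold plus in H; simpl in H.
    rewrite (Derive_ext _ (fun _ => 1)), Derive_const in H; [lra |].
    intros t; apply Hpq. }
  assert (Hk : forall s, B * (Im (X s) * p s - Re (X s) * q s)
                         = Derive q s * p s - Derive p s * q s).
  { intros s; assert (H := HE s).
    rewrite (curvature_arclength _ _ HA) in H.
    unfold normal in H; rewrite (tangent_arclength _ _ HA) in H.
    change (B * (Re (X s) * (0 * p s - 1 * q s)
                 - Im (X s) * - (0 * q s + 1 * p s))
            = Derive p s * (0 * p s - 1 * q s)
              - Derive q s * - (0 * q s + 1 * p s)) in H.
    ring_simplify in H; ring_simplify; lra. }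
  split; [intros s; apply Derive_correct, (Hx 1%nat) |].
  split; [intros s; apply Derive_correct, (Hy 1%nat) |].
  split; [exact Hpq | split; intros s].
  - replace (- _) with (Derive p s); [apply Hp |].
    rewrite Hk; specialize (Horth s).
    transitivity (Derive p s * (p s ^ 2 + q s ^ 2)); [rewrite Hpq; ring |].
    transitivity (p s * (p s * Derive p s) + Derive p s * q s ^ 2); [ring |].
    replace (p s * Derive p s) with (- (q s * Derive q s)) by lra; ring.
  - replace (_ * p s) with (Derive q s); [apply Hq |].
    rewrite Hk; specialize (Horth s).
    transitivity (Derive q s * (p s ^ 2 + q s ^ 2)); [rewrite Hpq; ring |].
    transitivity (q s * (q s * Derive q s) + Derive q s * p s ^ 2); [ring |].
    replace (q s * Derive q s) with (- (p s * Derive p s)) by lra; ring.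
Qed.

Lemma is_derive_affine_comp (f : R -> R) (c eps s0 s l : R) :
  is_derive f (s0 + eps * s) l ->
  is_derive (fun s => c * f (s0 + eps * s)) s (c * (eps * l)).
Proof.
  intros H; apply (is_derive_scal (fun s => f (s0 + eps * s))).
  apply (is_derive_comp f (fun s => s0 + eps * s)); [exact H |].
  auto_derive; [exact I | ring].
Qed.

(* Every expander is a rotated, shifted and possibly reversed [model]: the
   tangential part of the position has slope at least 1, hence a zero [s0], and
   reversing the curve makes its normal part at [s0] nonnegative. *)
Lemma expander_normal_form (B : R) (X : R -> C) :
  0 < B -> expander B X ->
  exists d tau nu theta beta eps s0,
    0 <= d /\ profile B d tau nu theta /\ (eps = 1 \/ eps = -1) /\
    forall s, X s = placed beta eps s0 (model tau nu theta) s.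
Proof.
  intros HB HX.
  destruct (expander_frame B X HX) as [p [q [Hx [Hy [Hpq [Hp Hq]]]]]].
  set (x := fun s => Re (X s)) in *; set (y := fun s => Im (X s)) in *.
  (* [t] and [n] are the components [<X, T>] and [<X, N>] of the position. *)
  set (t := fun s => x s * p s + y s * q s).
  set (n := fun s => y s * p s - x s * q s).
  assert (Hprod : forall f g s f' g', is_derive f s f' -> is_derive g s g' ->
            is_derive (fun s => f s * g s) s (f' * g s + f s * g')).
  { intros; apply (is_derive_mult f g); auto; intros; apply Rmult_comm. }
  assert (Ht : forall s, is_derive t s (1 + B * n s ^ 2)).
  { intros s.
    replace (1 + B * n s ^ 2) with
      (plus (p s * p s + x s * - (B * n s * q s))
            (q s * q s + y s * (B * n s * p s))).
    - apply (is_derive_plus (fun s => x s * p s) (fun s => y s * q s));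
        apply Hprod; [apply Hx | apply Hp | apply Hy | apply Hq].
    - rewrite <- (Hpq s); unfold plus, n; simpl; ring. }
  assert (Hn : forall s, is_derive n s (- (B * t s * n s))).
  { intros s.
    replace (- (B * t s * n s)) with
      (minus (q s * p s + y s * - (B * n s * q s))
             (p s * q s + x s * (B * n s * p s))).
    - apply (is_derive_minus (fun s => y s * p s) (fun s => x s * q s));
        apply Hprod; [apply Hy | apply Hp | apply Hx | apply Hq].
    - unfold minus, plus, opp; simpl; unfold t; ring. }
  destruct (inverse_function t _ 1 Rlt_0_1 Ht) as [T [_ [tT _]]].
  { intros s; assert (0 <= B * n s ^ 2) by nra; lra. }
  set (s0 := T 0); assert (Hs0 : t s0 = 0) by apply tT.
  assert (Heps : exists eps, (eps = 1 \/ eps = -1) /\ 0 <= eps * n s0).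
  { destruct (Rle_dec 0 (n s0)); [exists 1 | exists (-1)]; split; auto; lra. }
  destruct Heps as [eps [Heps Hd]].
  assert (Heps2 : eps * eps = 1) by (destruct Heps; subst; ring).
  (* [beta] is the direction of the tangent at the closest point, after the possible reversal. *)
  destruct (unit_vector_angle (eps * p s0) (eps * q s0)) as [beta [Hbc Hbs]].
  { replace (_ + _) with (eps * eps * (p s0 ^ 2 + q s0 ^ 2)) by ring.
    rewrite Heps2, Hpq; ring. }
  (* Reversal negates both [T] and [N], so the components of the position and the coordinates of the
     tangent all transform by the same rule. *)
  set (re := fun f : R -> R => fun s => eps * f (s0 + eps * s)).
  destruct (continuous_primitive (fun s => B * re n s) 0) as [theta [th0 Hth]].
  { intros s; apply (ex_derive_scal (re n)); eexists.
    apply is_derive_affine_comp, Hn. }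
  assert (P : profile B (eps * n s0) (re t) (re n) theta).
  { constructor; auto; unfold re.
    - rewrite Rmult_0_r, Rplus_0_r, Hs0; ring.
    - now rewrite Rmult_0_r, Rplus_0_r.
    - intros s.
      replace (1 + B * (eps * n (s0 + eps * s)) ^ 2)
        with (eps * (eps * (1 + B * n (s0 + eps * s) ^ 2))).
      + apply is_derive_affine_comp, Ht.
      + transitivity (eps * eps + B * (eps * n (s0 + eps * s)) ^ 2); [ring |].
        now rewrite Heps2.
    - intros s.
      replace (- _) with (eps * (eps * - (B * t (s0 + eps * s)
                                          * n (s0 + eps * s)))) by ring.
      apply is_derive_affine_comp, Hn. }
  exists (eps * n s0), (re t), (re n), theta, beta, eps, s0.
  split; [exact Hd | split; [exact P | split; [exact Heps |]]].
  set (Pf := re p); set (Qf := re q).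
  assert (HP : forall s, is_derive Pf s (- (B * re n s * Qf s))).
  { intros s; unfold Pf, Qf, re.
    replace (- _) with (eps * (eps * - (B * n (s0 + eps * s)
                                        * q (s0 + eps * s)))) by ring.
    apply is_derive_affine_comp, Hp. }
  assert (HQ : forall s, is_derive Qf s (B * re n s * Pf s)).
  { intros s; unfold Pf, Qf, re.
    replace (_ * (eps * p _)) with (eps * (eps * (B * n (s0 + eps * s)
                                        * p (s0 + eps * s)))) by ring.
    apply is_derive_affine_comp, Hq. }
  assert (P0 : Pf 0 = cos beta)
    by (unfold Pf, re; now rewrite Rmult_0_r, Rplus_0_r).
  assert (Q0 : Qf 0 = sin beta)
    by (unfold Qf, re; now rewrite Rmult_0_r, Rplus_0_r).
  assert (Hcos : forall s, is_derive (fun s => cos (beta + theta s)) s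
                             (- (B * re n s * sin (beta + theta s)))).
  { intros s; replace (- _) with
      (scal (B * re n s) (- sin (beta + theta s)))
      by (unfold scal; simpl; unfold mult; simpl; ring).
    apply (is_derive_comp cos (fun s => beta + theta s));
      [apply is_derive_cos |].
    rewrite <- (Rplus_0_l (B * re n s)).
    apply (is_derive_plus (fun _ => beta) theta);
      [apply (is_derive_const beta) | apply Hth]. }
  assert (Hsin : forall s, is_derive (fun s => sin (beta + theta s)) s
                             (B * re n s * cos (beta + theta s))).
  { intros s.
    apply (is_derive_comp sin (fun s => beta + theta s));
      [apply is_derive_sin |].
    rewrite <- (Rplus_0_l (B * re n s)).
    apply (is_derive_plus (fun _ => beta) theta);
      [apply (is_derive_const beta) | apply Hth]. }
  (* The unit vectors [(Pf, Qf)] and [e^{i (beta + theta)}] solve the same linear rotation equation.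
     Their inner and cross products are therefore constant, equal to 1 and 0 as at parameter 0, and
     the vectors agree. *)
  assert (Hdot : forall s,
            Pf s * cos (beta + theta s) + Qf s * sin (beta + theta s) = 1).
  { intros s.
    rewrite (derivative_zero_constant
      (fun s => Pf s * cos (beta + theta s) + Qf s * sin (beta + theta s)) s 0).
    - rewrite P0, Q0, th0, Rplus_0_r.
      assert (E := sin2_cos2 beta); unfold Rsqr in E; lra.
    - intros r; replace 0 with
        (plus (- (B * re n r * Qf r) * cos (beta + theta r)
               + Pf r * - (B * re n r * sin (beta + theta r)))
              (B * re n r * Pf r * sin (beta + theta r)
               + Qf r * (B * re n r * cos (beta + theta r))))
        by (unfold plus; simpl; ring).
      apply (is_derive_plus (fun s => Pf s * cos (beta + theta s))
                            (fun s => Qf s * sin (beta + theta s)));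
        [apply (Hprod Pf (fun s => cos (beta + theta s)))
        | apply (Hprod Qf (fun s => sin (beta + theta s)))]; auto. }
  assert (Hcross : forall s,
            Qf s * cos (beta + theta s) - Pf s * sin (beta + theta s) = 0).
  { intros s.
    rewrite (derivative_zero_constant
      (fun s => Qf s * cos (beta + theta s) - Pf s * sin (beta + theta s)) s 0).
    - rewrite P0, Q0, th0, Rplus_0_r; ring.
    - intros r; replace 0 with
        (minus (B * re n r * Pf r * cos (beta + theta r)
               + Qf r * - (B * re n r * sin (beta + theta r)))
              (- (B * re n r * Qf r) * sin (beta + theta r)
               + Pf r * (B * re n r * cos (beta + theta r))))
        by (unfold minus, plus, opp; simpl; ring).
      apply (is_derive_minus (fun s => Qf s * cos (beta + theta s))
                            (fun s => Pf s * sin (beta + theta s)));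
        [apply (Hprod Qf (fun s => cos (beta + theta s)))
        | apply (Hprod Pf (fun s => sin (beta + theta s)))]; auto. }
  intros s.
  set (r := eps * (s - s0)).
  assert (Hr : s0 + eps * r = s).
  { transitivity (s0 + eps * eps * (s - s0)); [unfold r; ring |].
    rewrite Heps2; ring. }
  assert (Hc : eps * p s = cos (beta + theta r)
               /\ eps * q s = sin (beta + theta r)).
  { assert (H1 := Hdot r); assert (H2 := Hcross r).
    unfold Pf, Qf, re in H1, H2; rewrite Hr in H1, H2.
    set (c := cos (beta + theta r)) in *; set (e := sin (beta + theta r)) in *.
    assert (H3 : e * e + c * c = 1) by apply (sin2_cos2 (beta + theta r)).
    split.
    - replace (eps * p s) with (eps * p s * (e * e + c * c))
        by (rewrite H3; ring).
      replace (eps * p s * (e * e + c * c)) with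
        (c * (eps * p s * c + eps * q s * e)
         - e * (eps * q s * c - eps * p s * e)) by ring.
      rewrite H1, H2; ring.
    - replace (eps * q s) with (eps * q s * (e * e + c * c))
        by (rewrite H3; ring).
      replace (eps * q s * (e * e + c * c)) with
        (e * (eps * p s * c + eps * q s * e)
         + c * (eps * q s * c - eps * p s * e)) by ring.
      rewrite H1, H2; ring. }
  destruct Hc as [Hc1 Hc2].
  rewrite cos_plus in Hc1; rewrite sin_plus in Hc2.
  rewrite (surjective_pairing (X s)); unfold placed; fold r.
  unfold Cmult, expi, model; simpl.
  unfold re at 1 2 3 4 5 6 7 8; rewrite Hr.
  (* Both sides are [t T + n N]; the signs cancel through [eps * eps = 1]. *)
  apply (f_equal2 pair).
  - transitivity (t s * p s - n s * q s).
    + transitivity (x s * (p s ^ 2 + q s ^ 2)); [rewrite Hpq; unfold x, Re; ring |].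
      unfold t, n; ring.
    + transitivity (eps * t s * (eps * p s) - eps * n s * (eps * q s)).
      * transitivity (eps * eps * (t s * p s - n s * q s)); [ | ring].
        rewrite Heps2; ring.
      * rewrite Hc1, Hc2; ring.
  - transitivity (t s * q s + n s * p s).
    + transitivity (y s * (p s ^ 2 + q s ^ 2)); [rewrite Hpq; unfold y, Im; ring |].
      unfold t, n; ring.
    + transitivity (eps * t s * (eps * q s) + eps * n s * (eps * p s)).
      * transitivity (eps * eps * (t s * q s + n s * p s)); [ | ring].
        rewrite Heps2; ring.
      * rewrite Hc1, Hc2; ring.
Qed.

Lemma placed_normal (B d : R) (tau nu theta : R -> R) (beta eps s0 : R)
    (X : R -> C) :
  profile B d tau nu theta -> arclength_curve X ->
  (forall s, X s = placed beta eps s0 (model tau nu theta) s) ->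
  forall s, normal X s = (- (eps * sin (beta + theta (eps * (s - s0)))),
                          eps * cos (beta + theta (eps * (s - s0)))).
Proof.
  intros P HA HX s.
  unfold normal; rewrite (tangent_arclength _ _ HA).
  set (M := model tau nu theta) in *; set (r := eps * (s - s0)).
  destruct (model_derive _ _ _ _ _ P r) as [H1 H2]; fold M in H1, H2.
  assert (Haff : is_derive (fun s => eps * (s - s0)) s eps)
    by (auto_derive; [exact I | ring]).
  assert (K1 : is_derive (fun s => Re (M (eps * (s - s0)))) s
                 (eps * cos (theta r)))
    by now apply (is_derive_comp (fun s => Re (M s)) (fun s => eps * (s - s0))).
  assert (K2 : is_derive (fun s => Im (M (eps * (s - s0)))) s
                 (eps * sin (theta r)))
    by now apply (is_derive_comp (fun s => Im (M s)) (fun s => eps * (s - s0))).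
  assert (E : vderiv X s = (eps * cos (beta + theta r),
                            eps * sin (beta + theta r))).
  { rewrite cos_plus, sin_plus.
    unfold vderiv; f_equal; apply is_derive_unique.
    - apply is_derive_ext with
        (fun s => minus (cos beta * Re (M (eps * (s - s0))))
                        (sin beta * Im (M (eps * (s - s0))))).
      { intros u; now rewrite HX. }
      replace (eps * _) with
        (minus (cos beta * (eps * cos (theta r)))
               (sin beta * (eps * sin (theta r))))
        by (unfold minus, plus, opp; simpl; ring).
      apply (is_derive_minus (fun s => cos beta * Re (M (eps * (s - s0))))
                             (fun s => sin beta * Im (M (eps * (s - s0)))));
        now apply is_derive_scal.
    - apply is_derive_ext with
        (fun s => plus (cos beta * Im (M (eps * (s - s0))))
                       (sin beta * Re (M (eps * (s - s0))))).
      { intros u; now rewrite HX. }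
      replace (eps * _) with
        (plus (cos beta * (eps * sin (theta r)))
              (sin beta * (eps * cos (theta r))))
        by (unfold plus; simpl; ring).
      apply (is_derive_plus (fun s => cos beta * Im (M (eps * (s - s0))))
                            (fun s => sin beta * Re (M (eps * (s - s0)))));
        now apply is_derive_scal. }
  rewrite E; unfold Cmult, Ci; simpl; f_equal; ring.
Qed.

(** * Convexity, proper embedding and the even graph *)

(** The height over the tangent line at [s] has derivative [sin (theta r - theta s)]. As [theta] is
    monotone with total variation below [PI], this has the sign of [r - s], so the height is least
    at [s]. *)
Lemma model_supporting_line (B d : R) (tau nu theta : R -> R) :
  0 < B -> 0 <= d -> profile B d tau nu theta ->
  forall s r,
    0 <= (Im (model tau nu theta r) - Im (model tau nu theta s)) * cos (theta s)
         - (Re (model tau nu theta r) - Re (model tau nu theta s)) * sin (theta s).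
Proof.
  intros HB Hd P s r; set (M := model tau nu theta).
  destruct (profile_limit_angle _ _ _ _ _ HB Hd P) as [L [HL [Hab _]]].
  assert (Hmono := profile_theta_increasing _ _ _ _ _ HB Hd P).
  set (h := fun r => cos (theta s) * Im (M r) - sin (theta s) * Re (M r)).
  assert (Hh : forall r, is_derive h r (sin (theta r - theta s))).
  { intros u; destruct (model_derive _ _ _ _ _ P u) as [H1 H2].
    replace (sin (theta u - theta s)) with
      (minus (cos (theta s) * sin (theta u)) (sin (theta s) * cos (theta u)))
      by (rewrite sin_minus; unfold minus, plus, opp; simpl; ring).
    apply (is_derive_minus (fun r => cos (theta s) * Im (M r))
                           (fun r => sin (theta s) * Re (M r)));
      now apply is_derive_scal. }
  assert (Hlt : forall u, - PI < theta u - theta s < PI).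
  { intros u; assert (A := Rabs_le_between (theta u) L).
    assert (A' := Rabs_le_between (theta s) L).
    assert (U := proj1 A (Hab u)); assert (V := proj1 A' (Hab s)); lra. }
  assert (H : h s <= h r); [ | unfold h in H; lra].
  destruct (Rle_dec s r) as [Hsr | Hsr].
  - assert (K : 0 * (r - s) <= h r - h s); [ | lra].
    apply (derivative_lower_bound _ _ _ _ _ Hh Hsr).
    intros x Hx; apply sin_ge_0; [ | apply Rlt_le, Hlt].
    specialize (Hmono s x ltac:(lra)); lra.
  - assert (K : 0 * (s - r) <= - h s - - h r); [ | lra].
    apply (derivative_lower_bound (fun r => - h r)
             (fun r => - sin (theta r - theta s))); [ | lra |].
    + intros x; now apply (is_derive_opp h).
    + intros x Hx; rewrite <- sin_neg; apply sin_ge_0.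
      * specialize (Hmono x s ltac:(lra)); lra.
      * specialize (Hlt x); lra.
Qed.

(* The slope of [Re M] is [cos theta >= cos L > 0]. *)
Lemma model_abscissa (B d : R) (tau nu theta : R -> R) :
  0 < B -> 0 <= d -> profile B d tau nu theta ->
  exists G, (forall s, G (Re (model tau nu theta s)) = s) /\
            (forall x, Re (model tau nu theta (G x)) = x).
Proof.
  intros HB Hd P.
  destruct (profile_limit_angle _ _ _ _ _ HB Hd P) as [L [HL [Hab _]]].
  destruct (inverse_function (fun s => Re (model tau nu theta s))
              (fun s => cos (theta s)) (cos L)) as [G [H1 [H2 _]]].
  - apply cos_gt_0; lra.
  - intros s; apply (model_derive _ _ _ _ _ P s).
  - intros s.
    assert (E : cos (theta s) = cos (Rabs (theta s))).
    { unfold Rabs; destruct (Rcase_abs (theta s)); [now rewrite cos_neg |].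
      reflexivity. }
    rewrite E; assert (A := Hab s); assert (A' := Rabs_pos (theta s)).
    apply cos_decr_1; lra.
  - now exists G.
Qed.

Lemma model_reflect (B d : R) (tau nu theta : R -> R) :
  0 < B -> 0 <= d -> profile B d tau nu theta ->
  forall s, model tau nu theta (- s) =
    (- Re (model tau nu theta s), Im (model tau nu theta s)).
Proof.
  intros HB Hd P s.
  destruct (profile_reflect _ _ _ _ _ HB Hd P s) as [E1 [E2 E3]].
  unfold model; simpl; rewrite E1, E2, E3, sin_neg, cos_neg; f_equal; ring.
Qed.

Lemma expander_convex (B : R) (X : R -> C) :
  0 < B -> expander B X -> convex_curve X.
Proof.
  intros HB HX s.
  destruct (expander_normal_form B X HB HX)
    as [d [tau [nu [theta [beta [eps [s0 [Hd [P [Heps E]]]]]]]]]].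
  (* The rotation drops out of the inner product, while the direction of travel multiplies the
     normal by [eps] and so selects the side. *)
  assert (H : forall r, exists h, 0 <= h /\
            inner (Cminus (X r) (X s)) (normal X s) = eps * h).
  { intros r.
    exists ((Im (model tau nu theta (eps * (r - s0)))
             - Im (model tau nu theta (eps * (s - s0))))
              * cos (theta (eps * (s - s0)))
            - (Re (model tau nu theta (eps * (r - s0)))
             - Re (model tau nu theta (eps * (s - s0))))
              * sin (theta (eps * (s - s0)))).
    split; [apply (model_supporting_line _ _ _ _ _ HB Hd P) |].
    rewrite (placed_normal _ _ _ _ _ _ _ _ _ P (proj1 HX) E).
    rewrite (E r), (E s), cos_plus, sin_plus.
    set (m := model tau nu theta (eps * (r - s0))).
    set (m' := model tau nu theta (eps * (s - s0))).
    set (th := theta (eps * (s - s0))).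
    transitivity (eps * ((Im m - Im m') * cos th - (Re m - Re m') * sin th)
                  * (Rsqr (sin beta) + Rsqr (cos beta))).
    - unfold placed; fold m m'; unfold inner, Rsqr, Re, Im; simpl; ring.
    - rewrite sin2_cos2; ring. }
  destruct Heps as [-> | ->]; [left | right];
    intros r; destruct (H r) as [h [Hh ->]]; lra.
Qed.

Lemma Cmod_placed (beta eps s0 : R) (M : R -> C) (s : R) :
  Cmod (placed beta eps s0 M s) = Cmod (M (eps * (s - s0))).
Proof. unfold placed; rewrite Cmod_mult, Cmod_expi; ring. Qed.

Lemma Cmod_model (tau nu theta : R -> R) (s : R) :
  Cmod (model tau nu theta s) = sqrt (tau s ^ 2 + nu s ^ 2).
Proof.
  unfold Cmod, model; simpl fst; simpl snd; f_equal.
  transitivity ((tau s ^ 2 + nu s ^ 2)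
                * (Rsqr (sin (theta s)) + Rsqr (cos (theta s)))).
  - unfold Rsqr; ring.
  - rewrite sin2_cos2; ring.
Qed.

Lemma Cmod_model_ge (B d : R) (tau nu theta : R -> R) :
  0 < B -> 0 <= d -> profile B d tau nu theta ->
  forall s, Rabs s <= Cmod (model tau nu theta s).
Proof.
  intros HB Hd P s; rewrite Cmod_model, <- sqrt_Rsqr_abs.
  apply sqrt_le_1_alt, Rle_trans with (Rsqr (tau s)).
  - apply Rsqr_le_abs_1, (profile_tau_abs_ge _ _ _ _ _ HB Hd P).
  - unfold Rsqr; nra.
Qed.

Lemma smooth_curve_continuous (X : R -> C) (s : R) :
  smooth_curve X -> filterlim X (locally s) (locally (X s)).
Proof.
  intros [Hx Hy].
  assert (Cx := ex_derive_continuous _ _ (Hx 1%nat s)).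
  assert (Cy := ex_derive_continuous _ _ (Hy 1%nat s)).
  intros Q [e He].
  assert (Bx := Cx _ (locally_ball (Re (X s)) e)).
  assert (By := Cy _ (locally_ball (Im (X s)) e)).
  unfold filtermap in *; generalize (filter_and _ _ Bx By).
  apply filter_imp; intros r [H1 H2]; apply He; split; assumption.
Qed.

(** Injectivity holds because the abscissa of the model determines the parameter. Properness comes
    from the distance to the origin being at least [Rabs (s - s0)], which bounds preimages of
    bounded sets. *)
Lemma expander_properly_embedded (B : R) (X : R -> C) :
  0 < B -> expander B X -> properly_embedded X.
Proof.
  intros HB HX.
  destruct (expander_normal_form B X HB HX)
    as [d [tau [nu [theta [beta [eps [s0 [Hd [P [Heps E]]]]]]]]]].
  destruct HX as [[Hsm Hunit] _].
  split; [ | split].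
  - split; [exact Hsm |]; intros s H0.
    specialize (Hunit s); rewrite H0, Cmod_0 in Hunit; lra.
  - intros s r Hsr.
    destruct (model_abscissa _ _ _ _ _ HB Hd P) as [G [HG _]].
    rewrite (E s), (E r) in Hsr; unfold placed in Hsr.
    apply (f_equal (Cmult (expi (- beta)))) in Hsr.
    rewrite !expi_cancel in Hsr.
    apply (f_equal (fun z => G (Re z))) in Hsr; rewrite !HG in Hsr.
    destruct Heps; subst eps; lra.
  - intros K HK [M HM]; apply compact_carac; split.
    + assert (Hcl : closed (fun s => K (X s))).
      { apply closed_comp; [ | exact HK].
        intros s; now apply smooth_curve_continuous. }
      intros s Hs; unfold complementary in Hs.
      destruct (open_not _ Hcl s Hs) as [e He].
      exists e; intros r Hr; apply He; exact Hr.
    + assert (Hb : forall s, K (X s) -> Rabs (s - s0) <= M).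
      { intros s Hs.
        assert (H := Cmod_model_ge _ _ _ _ _ HB Hd P (eps * (s - s0))).
        apply HM in Hs; rewrite E, Cmod_placed in Hs.
        rewrite Rabs_mult in H.
        replace (Rabs eps) with 1 in H; [lra |].
        destruct Heps; subst eps; unfold Rabs; destruct Rcase_abs; lra. }
      exists (s0 - M), (s0 + M); intros s Hs.
      assert (H := proj1 (Rabs_le_between _ _) (Hb s Hs)); lra.
Qed.

(** Rotating by [- beta] makes the tangent at the closest point horizontal. The inverse [G] of the
    abscissa is odd by the reflection symmetry, which makes the graph function even. *)
Lemma expander_even_graph (B : R) (X : R -> C) :
  0 < B -> expander B X ->
  exists th f, even_function f /\ is_graph_of (rotate th X) f.
Proof.
  intros HB HX.
  destruct (expander_normal_form B X HB HX)
    as [d [tau [nu [theta [beta [eps [s0 [Hd [P [Heps E]]]]]]]]]].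
  destruct (model_abscissa _ _ _ _ _ HB Hd P) as [G [GM MG]].
  set (M := model tau nu theta) in *.
  exists (- beta), (fun x => Im (M (G x))); split.
  - intros x.
    assert (HG : G (- x) = - G x).
    { rewrite <- (GM (- G x)); unfold M.
      rewrite (model_reflect _ _ _ _ _ HB Hd P); simpl.
      f_equal; f_equal; symmetry; apply MG. }
    rewrite HG; unfold M; now rewrite (model_reflect _ _ _ _ _ HB Hd P).
  - assert (Hrot : forall s, rotate (- beta) X s = M (eps * (s - s0))).
    { intros s; unfold rotate; rewrite E; apply expi_cancel. }
    intros x y; split.
    + intros [s Hs]; rewrite Hrot in Hs.
      replace x with (Re (M (eps * (s - s0)))) by now rewrite Hs.
      rewrite GM, Hs; reflexivity.
    + intros ->; exists (s0 + eps * G x); rewrite Hrot.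
      replace (eps * (s0 + eps * G x - s0)) with (G x)
        by (destruct Heps; subst eps; ring).
      rewrite <- (MG x) at 2; apply surjective_pairing.
Qed.

(** * The asymptotic cone *)

Lemma dist_to_bounds (E : C -> Prop) (z w : C) :
  E w -> 0 <= dist_to E z <= Cmod (Cminus z w).
Proof.
  intros Hw; unfold dist_to.
  destruct (Glb_Rbar_correct (fun r => exists w, E w /\ r = Cmod (Cminus z w)))
    as [H1 H2].
  specialize (H1 (Cmod (Cminus z w)) (ex_intro _ w (conj Hw eq_refl))).
  assert (H3 : Rbar_le 0
     (Glb_Rbar (fun r => exists w, E w /\ r = Cmod (Cminus z w)))).
  { apply H2; intros r [v [_ ->]]; apply Cmod_ge_0. }
  (* The infimum is finite, so [real] does not return its default value: [w] excludes [p_infty], and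
     nonnegativity of distances excludes [m_infty]. *)
  destruct (Glb_Rbar _) as [g | | ]; simpl in *; [lra | contradiction |].
  contradiction.
Qed.

Lemma sin_abs_le (x : R) : Rabs (sin x) <= Rabs x.
Proof.
  assert (H : forall x, 0 <= x -> Rabs (sin x) <= x).
  { intros u Hu; apply Rabs_le; split.
    - assert (K := derivative_lower_bound (fun u => u + sin u)
                     (fun u => 1 + cos u) 0 0 u).
      cbv beta in K; rewrite sin_0 in K.
      assert (0 * (u - 0) <= u + sin u - (0 + 0)); [ | lra].
      apply K; [ | exact Hu | intros v _; destruct (COS_bound v); lra].
      intros v; auto_derive; [exact I | ring].
    - assert (K := derivative_lower_bound (fun u => u - sin u)
                     (fun u => 1 - cos u) 0 0 u).
      cbv beta in K; rewrite sin_0 in K.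
      assert (0 * (u - 0) <= u - sin u - (0 - 0)); [ | lra].
      apply K; [ | exact Hu | intros v _; destruct (COS_bound v); lra].
      intros v; auto_derive; [exact I | ring]. }
  destruct (Rle_dec 0 x) as [Hx | Hx].
  - rewrite (Rabs_pos_eq x) by exact Hx; auto.
  - rewrite <- Rabs_Ropp, <- sin_neg, <- (Rabs_Ropp x), (Rabs_pos_eq (- x)) by lra.
    apply H; lra.
Qed.

(** The chord has length twice the absolute value of the sine of half the angle difference. *)
Lemma expi_lipschitz (a b : R) :
  Cmod (Cminus (expi a) (expi b)) <= Rabs (a - b).
Proof.
  rewrite <- sqrt_Rsqr_abs; unfold Cmod; apply sqrt_le_1_alt.
  transitivity (4 * Rsqr (sin ((a - b) / 2))).
  - right; set (u := (a + b) / 2); set (v := (a - b) / 2).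
    replace a with (u + v) by (unfold u, v; field).
    replace b with (u - v) by (unfold u, v; field).
    simpl; rewrite cos_plus, cos_minus, sin_plus, sin_minus.
    transitivity (4 * Rsqr (sin v) * (Rsqr (sin u) + Rsqr (cos u))).
    + unfold Rsqr; ring.
    + rewrite sin2_cos2; ring.
  - replace (Rsqr (a - b)) with (4 * Rsqr ((a - b) / 2)) by (unfold Rsqr; field).
    apply Rmult_le_compat_l; [lra |].
    apply Rsqr_le_abs_1, sin_abs_le.
Qed.

Lemma is_lim_zero_p_infty (f : R -> R) (K s0 : R) :
  (forall s, s0 + 1 <= s -> 0 <= f s <= K / (s - s0)) -> is_lim f p_infty 0.
Proof.
  intros H; apply is_lim_spec; intros eps.
  assert (He := cond_pos eps).
  assert (HK : 0 <= K).
  { destruct (H (s0 + 1) (Rle_refl _)) as [H1 H2].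
    replace (K / (s0 + 1 - s0)) with K in H2 by (field; lra); lra. }
  assert (HKe : 0 <= K / eps) by (apply Rdiv_le_0_compat; lra).
  exists (s0 + 1 + K / eps); intros s Hs.
  destruct (H s ltac:(lra)) as [H1 H2].
  rewrite Rminus_0_r, Rabs_pos_eq by exact H1.
  apply Rle_lt_trans with (1 := H2).
  apply Rmult_lt_reg_r with (s - s0); [lra |].
  replace (K / (s - s0) * (s - s0)) with K by (field; lra).
  apply Rle_lt_trans with (eps * (K / eps)); [right; field; lra |].
  apply Rmult_lt_compat_l; lra.
Qed.

Lemma is_lim_zero_m_infty (f : R -> R) (K s0 : R) :
  (forall s, s <= s0 - 1 -> 0 <= f s <= K / (s0 - s)) -> is_lim f m_infty 0.
Proof.
  intros H; apply is_lim_ext with (fun s => f (- - s)).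
  { intros s; now rewrite Ropp_involutive. }
  apply (is_lim_comp (fun s => f (- s)) Ropp m_infty 0 p_infty).
  - apply is_lim_zero_p_infty with K (- s0); intros s Hs.
    replace (s - - s0) with (s0 - - s) by ring; apply H; lra.
  - apply (is_lim_opp (fun s => s) m_infty m_infty), is_lim_id.
  - exists 0; discriminate.
Qed.

(** The comparison point on the ray is the one at distance [tau] from the origin. The difference
    splits as [tau (e^{i theta} - e^{i L}) + i nu e^{i theta}], of modulus at most
    [tau (L - theta) + nu <= nu (1 + tau)]. The other end follows by reflection in the imaginary
    axis, which turns the angle [L] into [PI - L]. *)
Lemma model_near_rays (B d : R) (tau nu theta : R -> R) :
  0 < B -> 0 <= d -> profile B d tau nu theta ->
  exists L K, 0 <= L < PI / 2 /\ forall beta s, 1 <= s ->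
    0 <= dist_to (ray (beta + L)) (Cmult (expi beta) (model tau nu theta s))
      <= K / s /\
    0 <= dist_to (ray (beta + (PI - L)))
           (Cmult (expi beta) (model tau nu theta (- s))) <= K / s.
Proof.
  intros HB Hd P.
  destruct (profile_limit_angle _ _ _ _ _ HB Hd P) as [L [HL [Hab HLn]]].
  destruct (profile_decay _ _ _ _ _ HB Hd P) as [K HK].
  exists L, K; split; [exact HL |]; intros beta s Hs.
  assert (Ht := profile_tau_ge _ _ _ _ _ HB P s ltac:(lra)).
  assert (Hn := profile_nu_nonneg _ _ _ _ _ Hd P s).
  assert (Hdist : Cmod (Cminus (model tau nu theta s)
                          (Cmult (RtoC (tau s)) (expi L))) <= K / s).
  { replace (Cminus _ _) with
      (Cplus (Cmult (RtoC (tau s)) (Cminus (expi (theta s)) (expi L)))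
             (Cmult (Cmult Ci (RtoC (nu s))) (expi (theta s)))).
    2: { unfold model, expi, Cminus, Cplus, Copp, Cmult, Ci, RtoC; simpl;
         f_equal; ring. }
    eapply Rle_trans; [apply Cmod_triangle |].
    rewrite !Cmod_mult, Cmod_expi, !Cmod_R, !Rabs_pos_eq by lra.
    replace (Cmod Ci) with 1
      by (unfold Cmod, Ci; simpl; replace (_ + _) with 1 by ring;
          now rewrite sqrt_1).
    eapply Rle_trans; [ | apply HK, Hs].
    assert (H := expi_lipschitz (theta s) L).
    assert (H1 := HLn s Hs).
    assert (H2 := proj1 (Rabs_le_between _ _) (Hab s)).
    rewrite Rabs_left1 in H by lra.
    assert (tau s * Cmod (Cminus (expi (theta s)) (expi L)) <= tau s * nu s)
      by (apply Rmult_le_compat_l; lra).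
    lra. }
  assert (Hrot : forall g z, Cmod (Cminus (Cmult (expi beta) z)
             (Cmult (RtoC (tau s)) (expi (beta + g))))
             = Cmod (Cminus z (Cmult (RtoC (tau s)) (expi g)))).
  { intros g z; rewrite <- expi_add.
    replace (Cminus _ _) with
      (Cmult (expi beta) (Cminus z (Cmult (RtoC (tau s)) (expi g)))) by ring.
    rewrite Cmod_mult, Cmod_expi; ring. }
  assert (Hray : forall a, ray a (Cmult (RtoC (tau s)) (expi a)))
    by (intros a; exists (tau s); split; [lra | reflexivity]).
  split.
  - destruct (dist_to_bounds _ (Cmult (expi beta) (model tau nu theta s)) _
                (Hray (beta + L))) as [H1 H2].
    rewrite Hrot in H2; lra.
  - destruct (dist_to_bounds _ (Cmult (expi beta) (model tau nu theta (- s))) _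
                (Hray (beta + (PI - L)))) as [H1 H2].
    rewrite Hrot in H2; split; [exact H1 |].
    eapply Rle_trans; [exact H2 | eapply Rle_trans; [right | exact Hdist]].
    rewrite (model_reflect _ _ _ _ _ HB Hd P); unfold Cmod; f_equal.
    unfold expi; rewrite Rtrigo_facts.cos_pi_minus, sin_PI_x.
    unfold Re, Im; simpl; ring.
Qed.

Lemma expander_asymptotic (B : R) (X : R -> C) :
  0 < B -> expander B X -> asymptotic_to_cone X.
Proof.
  intros HB HX.
  destruct (expander_normal_form B X HB HX)
    as [d [tau [nu [theta [beta [eps [s0 [Hd [P [Heps E]]]]]]]]]].
  destruct (model_near_rays _ _ _ _ _ HB Hd P) as [L [K [HL HK]]].
  (* The opening [PI - 2 L] is positive because [L < PI / 2] and at most [PI] because [0 <= L];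
     lines through the origin have [L = 0]. *)
  exists (beta + L), (beta + (PI - L)); split; [lra |].
  destruct Heps as [-> | ->]; [right | left]; split.
  - apply is_lim_zero_m_infty with K s0; intros s Hs; rewrite E; unfold placed.
    replace (1 * (s - s0)) with (- (s0 - s)) by ring; apply HK; lra.
  - apply is_lim_zero_p_infty with K s0; intros s Hs; rewrite E; unfold placed.
    rewrite Rmult_1_l; apply HK; lra.
  - apply is_lim_zero_m_infty with K s0; intros s Hs; rewrite E; unfold placed.
    replace (-1 * (s - s0)) with (s0 - s) by ring; apply HK; lra.
  - apply is_lim_zero_p_infty with K s0; intros s Hs; rewrite E; unfold placed.
    replace (-1 * (s - s0)) with (- (s - s0)) by ring; apply HK; lra.
Qed.

(** * Classification by the distance to the origin *)

Lemma placed_distance (B d : R) (tau nu theta : R -> R) (beta eps s0 : R)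
    (X : R -> C) :
  0 < B -> 0 <= d -> profile B d tau nu theta ->
  (forall s, X s = placed beta eps s0 (model tau nu theta) s) ->
  distance_to_origin X d.
Proof.
  intros HB Hd P E; split.
  - exists s0; rewrite E, Cmod_placed, Rminus_diag, Rmult_0_r, Cmod_model.
    rewrite (tau_0 _ _ _ _ _ P), (nu_0 _ _ _ _ _ P).
    replace (0 ^ 2 + d ^ 2) with (d ^ 2) by ring; now apply sqrt_pow2.
  - intros s; rewrite E, Cmod_placed, Cmod_model.
    rewrite <- (sqrt_pow2 d) at 1 by exact Hd.
    apply sqrt_le_1_alt, (profile_norm_ge _ _ _ _ _ HB Hd P).
Qed.

Lemma distance_to_origin_unique (X : R -> C) (d d' : R) :
  distance_to_origin X d -> distance_to_origin X d' -> d = d'.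
Proof.
  intros [[s Hs] H] [[s' Hs'] H'].
  specialize (H s'); specialize (H' s); lra.
Qed.

Lemma diffeomorphism_affine (a b : R) :
  a <> 0 -> diffeomorphism (fun s => a * s + b).
Proof.
  intros Ha; split; [apply smooth_affine |].
  exists (fun s => / a * s + - b / a); split; [apply smooth_affine |].
  split; intros s; field; exact Ha.
Qed.

Lemma expander_unique (B d : R) (X Y : R -> C) :
  0 < B -> expander B X -> distance_to_origin X d ->
  expander B Y -> distance_to_origin Y d ->
  same_up_to_rotation_and_reparametrization X Y.
Proof.
  intros HB HX HXd HY HYd.
  destruct (expander_normal_form B X HB HX)
    as [d1 [t1 [n1 [a1 [b1 [e1 [s1 [Hd1 [P1 [He1 E1]]]]]]]]]].
  destruct (expander_normal_form B Y HB HY)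
    as [d2 [t2 [n2 [a2 [b2 [e2 [s2 [Hd2 [P2 [He2 E2]]]]]]]]]].
  assert (d1 = d) by (eapply distance_to_origin_unique; [ | exact HXd];
                      exact (placed_distance _ _ _ _ _ _ _ _ _ HB Hd1 P1 E1)).
  assert (d2 = d) by (eapply distance_to_origin_unique; [ | exact HYd];
                      exact (placed_distance _ _ _ _ _ _ _ _ _ HB Hd2 P2 E2)).
  subst d1 d2.
  assert (HM : forall s, model t1 n1 a1 s = model t2 n2 a2 s).
  { intros s; unfold model.
    destruct (profile_unique _ _ _ _ _ _ _ _ HB Hd1 P1 P2 s) as [-> [-> ->]].
    reflexivity. }
  (* The reparametrization solves [e1 * (phi s - s1) = e2 * (s - s2)], using [e1 * e1 = 1]. *)
  exists (b2 - b1), (fun s => e1 * e2 * s + (s1 - e1 * e2 * s2)); split.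
  - apply diffeomorphism_affine; destruct He1, He2; subst; lra.
  - intros s; rewrite E2; unfold rotate; rewrite E1; unfold placed.
    rewrite Cmult_assoc, expi_add, HM.
    replace (b2 - b1 + b1) with b2 by ring.
    do 2 f_equal; destruct He1, He2; subst; ring.
Qed.

(** * Homothetic expansion under the flow *)

Lemma vderiv_scale (c : R) (X : R -> C) (s : R) :
  vderiv (fun u => Cmult (RtoC c) (X u)) s = Cmult (RtoC c) (vderiv X s).
Proof.
  unfold vderiv, Cmult, RtoC; simpl; apply (f_equal2 pair).
  - rewrite (Derive_ext _ (fun u => c * Re (X u))), Derive_scal; [ring |].
    intros t; unfold Re; ring.
  - rewrite (Derive_ext _ (fun u => c * Im (X u))), Derive_scal; [ring |].
    intros t; unfold Im; ring.
Qed.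

Lemma tangent_scale (c : R) (X : R -> C) (s : R) :
  0 < c -> arclength_curve X ->
  tangent (fun u => Cmult (RtoC c) (X u)) s = vderiv X s.
Proof.
  intros Hc [_ HX]; unfold tangent, arc_deriv.
  rewrite vderiv_scale, Cmod_mult, HX, Cmod_R, Rabs_pos_eq by lra.
  rewrite Rmult_1_r; field; intros H; apply RtoC_inj in H; lra.
Qed.

Lemma normal_scale (c : R) (X : R -> C) (s : R) :
  0 < c -> arclength_curve X ->
  normal (fun u => Cmult (RtoC c) (X u)) s = normal X s.
Proof.
  intros Hc HX; unfold normal.
  now rewrite (tangent_scale _ _ _ Hc HX), (tangent_arclength _ _ HX).
Qed.

(** The tangent is unchanged as a function of the parameter, while the element of arc length is
    multiplied by [c]. *)
Lemma curvature_scale (c : R) (X : R -> C) (s : R) :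
  0 < c -> arclength_curve X ->
  curvature (fun u => Cmult (RtoC c) (X u)) s = curvature X s / c.
Proof.
  intros Hc HX; rewrite (curvature_arclength _ _ HX); unfold curvature.
  rewrite (normal_scale _ _ _ Hc HX); unfold arc_deriv.
  rewrite vderiv_scale, Cmod_mult, (proj2 HX), Cmod_R, Rabs_pos_eq by lra.
  rewrite Rmult_1_r.
  replace (vderiv (tangent (fun u => Cmult (RtoC c) (X u))) s)
    with (vderiv (vderiv X) s).
  - generalize (normal X s) (vderiv (vderiv X) s); intros n w.
    unfold inner, Cdiv, Cinv, RtoC; simpl; field; lra.
  - apply (f_equal2 pair); apply Derive_ext; intros t;
      now rewrite (tangent_scale _ _ _ Hc HX).
Qed.

Lemma smooth_curve_scale (c : R) (X : R -> C) :
  smooth_curve X -> smooth_curve (fun u => Cmult (RtoC c) (X u)).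
Proof.
  intros [Hx Hy]; split; intros n s.
  - apply (ex_derive_n_ext (fun u => c * Re (X u)));
      [intros t; unfold Re; simpl; ring |].
    apply ex_derive_n_scal_l, Hx.
  - apply (ex_derive_n_ext (fun u => c * Im (X u)));
      [intros t; unfold Im; simpl; ring |].
    apply ex_derive_n_scal_l, Hy.
Qed.

Lemma filterdiff_within_of_is_derive (V : NormedModule R_AbsRing) (f : R -> V)
    (D : R -> Prop) (t : R) (l : V) :
  D t -> is_derive f t l ->
  filterdiff f (within D (locally t)) (fun h => scal h l).
Proof.
  intros Ht [Hlin H]; split; [exact Hlin |]; intros x Hx.
  (* [filterdiff] quantifies over all limits of the filter. Since [D t] holds, every ball around
     such a limit contains [t], which leaves only [t] itself. *)
  assert (x = t) as ->.
  { apply eq_close; intros e.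
    assert (K := Hx _ (locally_ball x e)); unfold within in K.
    exact (locally_singleton _ _ K Ht). }
  eapply is_domin_le; [apply H; intros P HP; exact HP |].
  apply filter_le_within; apply locally_filter.
Qed.

Lemma C_scal_Cmult (c : R) (z : C) :
  @scal R_AbsRing C_R_NormedModule c z = Cmult (RtoC c) z.
Proof.
  unfold scal; simpl; unfold prod_scal, scal; simpl; unfold mult; simpl.
  unfold Cmult, RtoC; simpl; f_equal; ring.
Qed.

(** The scaling function satisfies [g' = B / g]. The normal speed is therefore
    [B <X, N> / g = k / g], which is the curvature of the scaled curve. *)
Lemma expander_flow (B : R) (X : R -> C) :
  0 < B -> expander B X ->
  curve_shortening_flow X (fun u t => Cmult (RtoC (sqrt (2 * B * t + 1))) (X u)).
Proof.
  intros HB [HA HE].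
  assert (Hpos : forall t, 0 <= t -> 0 < 2 * B * t + 1) by (intros; nra).
  assert (Hg : forall t, 0 <= t -> 0 < sqrt (2 * B * t + 1))
    by (intros t Ht; now apply sqrt_lt_R0, Hpos).
  split; [ | split].
  - intros u; rewrite Rmult_0_r, Rplus_0_l, sqrt_1; apply Cmult_1_l.
  - intros t Ht; split; [apply smooth_curve_scale, HA |].
    intros u H; rewrite vderiv_scale in H.
    apply (f_equal Cmod) in H; rewrite Cmod_mult, (proj2 HA), Cmod_0 in H.
    rewrite Cmod_R, Rabs_pos_eq in H; specialize (Hg t Ht); lra.
  - intros u t Ht; specialize (Hg t Ht).
    set (g := sqrt (2 * B * t + 1)) in *.
    exists (Cmult (RtoC (B / g)) (X u)); split.
    + assert (D : is_derive (fun r => sqrt (2 * B * r + 1)) t (B / g)).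
      { replace (B / g) with (2 * B / (2 * g)) by (field; lra).
        apply (is_derive_sqrt (fun r => 2 * B * r + 1)); [ | now apply Hpos].
        auto_derive; [exact I | ring]. }
      apply filterdiff_within_of_is_derive; [exact Ht |].
      rewrite <- C_scal_Cmult.
      apply is_derive_ext
        with (fun r => @scal _ C_R_NormedModule (sqrt (2 * B * r + 1)) (X u));
        [intros r; apply C_scal_Cmult |].
      now apply is_derive_scal_l.
    + rewrite (normal_scale _ _ _ Hg HA), (curvature_scale _ _ _ Hg HA), <- HE.
      generalize (normal X u); intros n; unfold inner; simpl; field; lra.
Qed.

Theorem theorem6p1 (B : R) (HB : 0 < B) :
  (* (i) *)
  (forall X : R -> C, expander B X ->
     convex_curve X /\ properly_embedded X /\ asymptotic_to_cone X /\
     exists (th : R) (f : R -> R),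
       even_function f /\ is_graph_of (rotate th X) f) /\
  (* (ii) *)
  ((forall X : R -> C, expander B X ->
      exists d : R, 0 <= d /\ distance_to_origin X d) /\
   (forall d : R, 0 <= d ->
      (exists X : R -> C, expander B X /\ distance_to_origin X d) /\
      (forall X Y : R -> C,
         expander B X -> distance_to_origin X d ->
         expander B Y -> distance_to_origin Y d ->
         same_up_to_rotation_and_reparametrization X Y))) /\
  (* (iii) *)
  (forall X : R -> C, expander B X ->
     curve_shortening_flow X
       (fun u t => Cmult (RtoC (sqrt (2 * B * t + 1))) (X u))).
Proof.
  split; [ | split; [split |]].
  - intros X HX; split; [now apply (expander_convex B) |].
    split; [now apply (expander_properly_embedded B) |].
    split; [now apply (expander_asymptotic B) |].
    now apply (expander_even_graph B).
  - intros X HX.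
    destruct (expander_normal_form B X HB HX)
      as [d [tau [nu [theta [beta [eps [s0 [Hd [P [_ E]]]]]]]]]].
    exists d; split; [exact Hd |].
    exact (placed_distance _ _ _ _ _ _ _ _ _ HB Hd P E).
  - intros d Hd; split.
    + destruct (profile_exists B d HB Hd) as [tau [nu [theta P]]].
      exists (model tau nu theta); split; [now apply (model_expander B d) |].
      apply (placed_distance B d tau nu theta 0 1 0); auto.
      intros s; unfold placed, expi.
      rewrite cos_0, sin_0, Rminus_0_r, Rmult_1_l; symmetry; apply Cmult_1_l.
    + intros X Y HX HXd HY HYd; now apply (expander_unique B d).
  - intros X HX; now apply expander_flow.
Qed.
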